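(* Let $X$ and $Y$ be connected finite simple graphs. Then $\gamma(X)$ is isomorphic to $\gamma(Y)$ if and only if $X$ is isomorphic to $Y$.
   Context: All graphs are finite, without loops or multiple edges. For a graph $X$ with $m$ edges, orient each edge arbitrarily and label the oriented edges $e_1,\dots,e_m$; put $e_{m+i}=e_i^{-1}$ ($e_i$ with reversed direction), and write $s(e),t(e)$ for the starting and terminal vertex of an oriented edge $e$. The edge adjacency matrix $M$ is the $2m\times 2m$ matrix with $M_{ij}=1$ if $t(e_i)=s(e_j)$ and $s(e_i)\neq t(e_j)$, and $M_{ij}=0$ otherwise. The symmetric edge graph $\gamma(X)$ is the graph on the $2m$ vertices $e_1,\dots,e_{2m}$ with adjacency matrix $M+M^T$ (a $0/1$ symmetric matrix). Equivalently, the vertices of $\gamma(X)$ are the ordered pairs $(u,v)$ with $uv\in E(X)$, and $(u,v)$ is adjacent to $(x,y)$ iff ($v=x$ and $y\neq u$) or ($y=u$ and $x\neq v$). *)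

(* Defs.v *)
From HB Require Import structures.
From mathcomp Require Import all_boot.

Set Implicit Arguments.
Unset Strict Implicit.
Unset Printing Implicit Defensive.

Record sgraph := SGraph {
  vertex :> finType;
  adj : rel vertex;
  adj_sym : symmetric adj;
  adj_irrefl : irreflexive adj
}.

(* The graph with no vertices is not counted as connected; otherwise it and
   the one-vertex graph would both have the empty symmetric edge graph. *)
Definition connected_graph (X : sgraph) : Prop :=
  0 < #|X| /\ forall x y : X, connect (@adj X) x y.

Definition isomorphic (X Y : sgraph) : Prop :=
  exists f : X -> Y, bijective f /\ {mono f : x y / adj x y}.

(* Each edge gives two oriented edges (u, v) and (v, u), so this type plays the
   role of the list e_1, ..., e_2m, without choosing a labelling. *)
Definition oriented_edge (X : sgraph) := {e : X * X | adj e.1 e.2}.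

Section SymmetricEdgeGraph.
Variable X : sgraph.
Implicit Types a b : oriented_edge X.

Definition source a : X := (val a).1.
Definition target a : X := (val a).2.

(* The entries of the 0/1 edge adjacency matrix M, indexed by oriented edges. *)
Definition edge_adj a b : bool :=
  (target a == source b) && (source a != target b).

Definition gamma_adj a b : bool := edge_adj a b || edge_adj b a.

(* The adjacency matrix of the symmetric edge graph is M + M^T. *)
Lemma gamma_adjE a b : (gamma_adj a b : nat) = edge_adj a b + edge_adj b a.
Proof.
rewrite /gamma_adj /edge_adj (eq_sym (target b)) (eq_sym (source b)).
by case: (target a == source b); case: (source a == target b).
Qed.

Lemma gamma_adj_sym : symmetric gamma_adj.
Proof. by move=> a b; rewrite /gamma_adj orbC. Qed.

Lemma gamma_adj_irrefl : irreflexive gamma_adj.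
Proof.
move=> a; rewrite /gamma_adj orbb /edge_adj (eq_sym (source a)).
by rewrite andbN.
Qed.

Definition gamma : sgraph := SGraph gamma_adj_sym gamma_adj_irrefl.

End SymmetricEdgeGraph.

(* Main.v *)
(** An isomorphism of symmetric edge graphs that commutes with the reversal
    (u, v) |-> (v, u) comes from an isomorphism of the base graphs: neighbours
    b, c of an oriented edge a sit at the same end of a iff b = c or b is
    adjacent to the reverse of c, so directions are preserved or reversed
    globally. In general phi : gamma X -> gamma Y does not commute with
    reversal, and the point is to show that the reversal R1 of X is conjugate,
    among the automorphisms of gamma X, to the pulled-back reversal R2 of Y.

    If some vertex has degree at least 3, gamma X is connected. Conjugating R2
    by a power of R1 R2 makes the order of R1 R2 a power 2^k of 2. For k > 0
    the involution z in <R1 R2> commutes with R1, hence acts on X by an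
    involution s, as (u, v) |-> (s u, s v) or (u, v) |-> (s v, s u), and R1 z
    is again conjugate to R1 or R2. This makes X very special: a two-fold
    blow-up of a path or a cycle in the first case; in the second case a cubic
    graph of paths and cycles joined by edges between x and s x, or a subgraph
    of the cube, which the number of edges determines. In the first two
    families gamma X splits into two halves exchanged by R1 in such a way that
    z on one half and the identity on the other half form an automorphism,
    which conjugates R1 to R1 z; this settles k = 1. For k > 1 the square
    root w of z in <R1 R2> is incompatible with R1 w being a reversal. *)
Require Import Defs.
From mathcomp Require Import all_boot.

Set Implicit Arguments.
Unset Strict Implicit.
Unset Printing Implicit Defensive.

(** * Deterministic walks with a reversal *)

Section Walks.
Variables (V : Type) (N : V -> V -> Prop) (R : V -> V).

Fixpoint steps n x y : Prop :=
  if n is n'.+1 then exists2 t, N x t & steps n' t y else x = y.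

Lemma steps_rcons n x y t : steps n x y -> N y t -> steps n.+1 x t.
Proof.
elim: n x => [|n IHn] x /=; first by move=> -> Nyt; exists t.
by case=> s Nxs /IHn IH Nyt; exists s => //; apply: IH.
Qed.

Lemma steps_last n x y : steps n.+1 x y -> exists2 t, steps n x t & N t y.
Proof.
elim: n x => [|n IHn] x /=; first by case=> t Nxt <-; exists x.
case=> t Nxt /IHn [s ts Nsy]; exists s => //; by exists t.
Qed.

Hypothesis RK : involutive R.
Hypothesis N_fun : forall x y y', N x y -> N x y' -> y = y'.
Hypothesis N_rev : forall x y, N x y -> N (R y) (R x).
Hypothesis N_free : forall x y, N x y -> R x <> x.
Hypothesis N_nobt : forall x y, N x y -> y <> R x.

Lemma N_inj x x' y : N x y -> N x' y -> x = x'.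
Proof. by move=> /N_rev h /N_rev h'; apply: (can_inj RK); apply: N_fun h h'. Qed.

(* A walk from x to R x can be shortened at both ends. *)
Lemma no_return n x : R x <> x -> ~ steps n x (R x).
Proof.
have [m] := ubnP n; elim: m n x => // m IHm [|[|n]] x lt_n Rx.
- by move=> /= /esym.
- by case=> t Nxt /= E; case: (N_nobt Nxt).
case=> t Nxt /steps_last [s ts NsR].
have Es : s = R t by apply: N_inj NsR (N_rev Nxt).
apply: (IHm n t); first by rewrite -ltnS; apply: ltnW.
- by have := N_free (N_rev Nxt); rewrite RK => /nesym.
- by rewrite -Es.
Qed.

(** As [N] is single-valued in both directions, a further step either extends the directed walk
    between [x] and [y] or cancels its last step at [y]; zigzags thus straighten out. *)
Lemma steps_step n x y t : N t y \/ N y t ->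
  steps n x y \/ steps n y x -> exists m, steps m x t \/ steps m t x.
Proof.
case=> Nh [].
- case: n => [|n]; first by move=> /= ->; exists 1; right; exists y.
  by case/steps_last=> s xs Nsy; exists n; left; rewrite (N_inj Nh Nsy).
- by move=> yx; exists n.+1; right; exists y.
- by move=> xy; exists n.+1; left; apply: steps_rcons xy Nh.
case: n => [|n] /=; first by move=> <-; exists 1; left; exists t.
by case=> s Nys sx; exists n; right; rewrite (N_fun Nh Nys).
Qed.

(** The labels along an [S]-path form a zigzag of [N]-steps, which [steps_step] straightens to a
    directed walk between [lab a] and its reverse; [no_return] excludes it. *)
Lemma connect_no_return (T : finType) (S : rel T) (lab : T -> V) (a b : T) :
    (forall c d, S c d ->
       lab c = lab d \/ N (lab c) (lab d) \/ N (lab d) (lab c)) ->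
  R (lab a) <> lab a -> lab b = R (lab a) -> ~~ connect S a b.
Proof.
move=> S_lab Ra Eb; apply/negP => /connectP [p ap Ep].
pose linked c := exists m, steps m (lab a) (lab c) \/ steps m (lab c) (lab a).
have walk q c : path S c q -> linked c -> linked (last c q).
  elim: q c => [|d q IHq] c //= /andP[Scd dq] [m lc]; apply: IHq => //.
  case: (S_lab _ _ Scd) => [E|h]; first by exists m; rewrite -E.
  by apply: steps_step lc; case: h; [right | left].
have [|m] := walk p a ap; first by exists 0; left.
rewrite -Ep Eb => -[/(no_return Ra)//|]; rewrite -{2}(RK (lab a)).
by apply: no_return; rewrite RK; apply/nesym.
Qed.

End Walks.

(** * Comparing two orientations with the same sides *)

Section Orientations.
Variables (T : finType) (E O O' : rel T).
Hypothesis Esym : symmetric E.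
Hypothesis Oasym : forall a b, E a b -> O b a = ~~ O a b.
Hypothesis O'asym : forall a b, E a b -> O' b a = ~~ O' a b.
Hypothesis sides : forall a b c, E a b -> E a c ->
  (O a b == O a c) = (O' a b == O' a c).

Lemma orientation_local a :
  (forall b, E a b -> O' a b = O a b) \/ (forall b, E a b -> O' a b = O b a).
Proof.
case: (pickP (E a)) => [b Eab|no]; last by left=> b; rewrite no.
case Ob: (O' a b == O a b); [left|right] => c Eac; have := sides Eab Eac;
  rewrite ?(Oasym Eac);
  by move: Ob; case: (O a b); case: (O a c); case: (O' a b); case: (O' a c).
Qed.

(** Asymmetry carries the agreement across the edge from [a] to [d], and [sides] spreads it from the
    neighbour [a] of [d] to all other neighbours. *)
Lemma orientation_connect a b : connect E a b ->
  (forall c, E a c -> O' a c = O a c) -> (forall c, E b c -> O' b c = O b c).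
Proof.
case/connectP=> p; elim: p a => [|d p IHp] a /=; first by move=> _ ->.
case/andP=> Ead pd Eb agr; apply: (IHp d) => // c Edc.
have Eda : E d a by rewrite Esym.
have h : O' d a = O d a by rewrite (O'asym Ead) (Oasym Ead) agr.
have := sides Eda Edc; rewrite h.
by case: (O d a); case: (O d c); case: (O' d c).
Qed.
End Orientations.

Section OrientationsConnected.
Variables (T : finType) (E O O' : rel T).
Hypothesis Esym : symmetric E.
Hypothesis Oasym : forall a b, E a b -> O b a = ~~ O a b.
Hypothesis O'asym : forall a b, E a b -> O' b a = ~~ O' a b.
Hypothesis sides : forall a b c, E a b -> E a c ->
  (O a b == O a c) = (O' a b == O' a c).

Lemma orientation_connect_opp a b : connect E a b ->
  (forall c, E a c -> O' a c = O c a) -> (forall c, E b c -> O' b c = O c b).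
Proof.
apply: (@orientation_connect T E (fun x y => O y x) O') => //.
  by move=> x y Exy; rewrite (Oasym Exy) negbK.
move=> x y t Exy Ext; rewrite (Oasym Exy) (Oasym Ext) -(sides Exy Ext).
by case: (O x y); case: (O x t).
Qed.

Lemma orientation_global : (forall a b, connect E a b) ->
  (forall a b, E a b -> O' a b = O a b) \/ (forall a b, E a b -> O' a b = O b a).
Proof.
move=> conn; case: (pickP (fun _ : T => true)) => [a _|no]; last first.
  by left=> a; have := no a.
case: (orientation_local Oasym sides a) => h; [left|right] => b c Ebc.
  exact: (orientation_connect Esym Oasym O'asym sides (conn a b) h).
exact: (orientation_connect_opp (conn a b) h).
Qed.
End OrientationsConnected.

(** * Abstract reversals and the sides they define *)

Ltac eqcases :=
  repeat match goal with
  | |- context [?x == ?y] =>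
      case: (x =P y) => ? //=; try (exfalso; congruence)
  end.

(* R behaves like the reversal of oriented edges, and O like the relation
   edge_adj. By revl_side, E and R determine which neighbours of a are at the
   same end of a. *)
Record reversal (T : finType) (E : rel T) (R : T -> T) (O : rel T) : Prop :=
  Reversal {
    revlK : involutive R;
    revlE : forall a b, E a b = O a b || O b a;
    revlN : forall a b, O a b -> ~~ O b a;
    revlR : forall a b, O (R a) (R b) = O b a;
    revl_side : forall a b c, E a b -> E a c ->
      (O a b == O a c) = (b == c) || E b (R c);
    revl_free : forall a, R a != a;
    revl_far1 : forall a, ~~ E a (R a);
    revl_far2 : forall a b, E a b -> ~~ E (R a) b
  }.

Definition same_side (T : finType) (E : rel T) (R : T -> T) (b c : T) :=
  (b == c) || E b (R c).

Section Reversal.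
Variables (T : finType) (E O : rel T) (R : T -> T).
Hypothesis rv : reversal E R O.

Lemma revl_sym : symmetric E.
Proof. by move=> a b; rewrite !(revlE rv) orbC. Qed.

Lemma revl_asym a b : E a b -> O b a = ~~ O a b.
Proof.
rewrite (revlE rv); move: (@revlN _ _ _ _ rv a b).
by case: (O a b); case: (O b a) => // ->.
Qed.

Lemma revl_mono a b : E (R a) (R b) = E a b.
Proof. by rewrite !(revlE rv) !(revlR rv) orbC. Qed.

Lemma revl_inj : injective R.
Proof. exact: can_inj (revlK rv). Qed.

Lemma revl_connect a b : connect E a b -> connect E (R a) (R b).
Proof.
case/connectP=> p; elim: p a => [|d p IHp] a /=; first by move=> _ ->.
case/andP=> Ead pd Eb; apply: connect_trans (IHp d pd Eb).
by apply: connect1; rewrite revl_mono.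
Qed.

Section Sides.
Variables (a b c d : T).
Hypotheses (Eb : E a b) (Ec : E a c) (Ed : E a d).

Lemma side_sym : same_side E R b c = same_side E R c b.
Proof. by rewrite /same_side -!(revl_side rv Eb, revl_side rv Ec) // eq_sym. Qed.

Lemma side_trans : same_side E R b c -> same_side E R b d -> same_side E R c d.
Proof.
rewrite /same_side -(revl_side rv Eb Ec) -(revl_side rv Eb Ed).
by rewrite -(revl_side rv Ec Ed) => /eqP <- /eqP <-.
Qed.

Lemma side_pigeon :
  [|| same_side E R b c, same_side E R b d | same_side E R c d].
Proof.
rewrite /same_side -(revl_side rv Eb Ec) -(revl_side rv Eb Ed).
by rewrite -(revl_side rv Ec Ed); case: (O a b); case: (O a c); case: (O a d).
Qed.
End Sides.
End Reversal.

(** This turns the reversal of [Y] into a second reversal on [gamma X]. *)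
Lemma reversal_transport (T T' : finType) (E : rel T) (E' O' : rel T')
    (R : T -> T) (R' : T' -> T') (f : T -> T') :
  bijective f -> {mono f : a b / E a b >-> E' a b} ->
  (forall a, f (R a) = R' (f a)) ->
  reversal E' R' O' -> reversal E R (relpre f O').
Proof.
move=> /bij_inj fI fE fR rv; split=> /=.
- by move=> a; apply: fI; rewrite !fR (revlK rv).
- by move=> a b; rewrite -fE (revlE rv).
- by move=> a b; apply: (revlN rv).
- by move=> a b; rewrite !fR (revlR rv).
- move=> a b c Eb Ec; rewrite (revl_side rv) ?fE //.
  by rewrite (inj_eq fI) -fR fE.
- by move=> a; rewrite -(inj_eq fI) fR (revl_free rv).
- by move=> a; rewrite -fE fR (revl_far1 rv).
- by move=> a b Eab; rewrite -fE fR (revl_far2 rv) ?fE.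
Qed.

(** * Oriented edges and their reversal *)

Section OrientedEdges.
Variable X : sgraph.
Implicit Types (u v x y : X) (a b : oriented_edge X).

Local Notation E := (@gamma_adj X).

Definition oedge u v (uv : adj u v) : oriented_edge X :=
  exist (fun e : X * X => adj e.1 e.2) (u, v) uv.

Definition rev_edge a : oriented_edge X :=
  oedge (etrans (adj_sym (target a) (source a)) (valP a)).

Lemma source_oedge u v (uv : adj u v) : source (oedge uv) = u. Proof. by []. Qed.
Lemma target_oedge u v (uv : adj u v) : target (oedge uv) = v. Proof. by []. Qed.
Lemma source_rev a : source (rev_edge a) = target a. Proof. by []. Qed.
Lemma target_rev a : target (rev_edge a) = source a. Proof. by []. Qed.
Lemma oedge_adj a : adj (source a) (target a). Proof. exact: (valP a). Qed.

Definition oedgeE := (source_oedge, target_oedge, source_rev, target_rev).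

Lemma oedge_inj a b : source a = source b -> target a = target b -> a = b.
Proof.
by case: a b => [[u v] p] [[x y] q] /= h h'; apply: val_inj; congr (_, _).
Qed.

Lemma oedge_eq a b : (a == b) = (source a == source b) && (target a == target b).
Proof.
apply/eqP/andP => [->|[/eqP h /eqP h']]; first by rewrite !eqxx.
exact: oedge_inj.
Qed.

Lemma gadjE a b : E a b =
  (target a == source b) && (source a != target b)
  || (target b == source a) && (source b != target a).
Proof. by []. Qed.

Lemma adj_neq u v : adj u v -> u != v.
Proof. by apply: contraTneq => ->; rewrite adj_irrefl. Qed.

Lemma source_neq_target a : source a != target a.
Proof. exact: adj_neq (oedge_adj a). Qed.

Lemma rev_edgeK : involutive rev_edge.
Proof. by move=> a; apply: oedge_inj. Qed.

Lemma edge_adj_rev a b : edge_adj (rev_edge a) (rev_edge b) = edge_adj b a.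
Proof. by rewrite /edge_adj !oedgeE (eq_sym (source a)) (eq_sym (target a)). Qed.

Lemma reversal_rev_edge : reversal E rev_edge (@edge_adj X).
Proof.
split=> //.
- exact: rev_edgeK.
- move=> a b /andP[/eqP h _]; rewrite /edge_adj.
  by rewrite -h eqxx andbF.
- exact: edge_adj_rev.
- move=> a b c; rewrite !gadjE /edge_adj oedge_eq !oedgeE.
  move: (source_neq_target a) (source_neq_target b) (source_neq_target c).
  by move=> /eqP ? /eqP ? /eqP ?; eqcases.
- move=> a; rewrite oedge_eq !oedgeE negb_and eq_sym.
  by rewrite source_neq_target.
- by move=> a; rewrite gadjE !oedgeE !eqxx.
- move=> a b; rewrite !gadjE !oedgeE.
  move: (source_neq_target a) (source_neq_target b).
  by move=> /eqP ? /eqP ?; eqcases.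
Qed.

End OrientedEdges.

(** * Connectedness of a graph and of its symmetric edge graph *)

Lemma connected_ind (X : sgraph) (P : X -> Prop) x :
    connected_graph X -> P x -> (forall u v, adj u v -> P u -> P v) ->
  forall y, P y.
Proof.
move=> [_ conn] Px Padj y; case/connectP: (conn x y) => p xp ->.
elim: p x Px xp {conn} => [|z p IHp] x Px //= /andP[xz zp].
exact: IHp (Padj _ _ xz Px) zp.
Qed.

Lemma ex_target (X : sgraph) (a : oriented_edge X) : connected_graph X ->
  forall v, exists b : oriented_edge X, target b = v.
Proof.
move=> connX; apply: (connected_ind (x := target a) connX); first by exists a.
by move=> u v uv _; exists (oedge uv).
Qed.

Section ConnectOrRev.
Variable X : sgraph.
Hypothesis connX : connected_graph X.
Local Notation E := (@gamma_adj X).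
Local Notation rvX := (reversal_rev_edge X).

Lemma gconnect_sym : connect_sym E.
Proof. exact: sym_connect_sym (revl_sym rvX). Qed.

(** The edges reached from [a] or its reverse are closed under reversal, hence under passing to any
    edge that starts where a reached one ends; connectedness of [X] does the rest. *)
Lemma connect_or_rev (a b : oriented_edge X) :
  connect E a b || connect E (rev_edge a) b.
Proof.
pose D (c : oriented_edge X) := connect E a c || connect E (rev_edge a) c.
have Drev c : D c -> D (rev_edge c).
  by case/orP=> /(revl_connect rvX); rewrite /D ?rev_edgeK => ->; rewrite ?orbT.
have Dadj c d : E c d -> D c -> D d.
  move=> Ecd; rewrite /D => /orP[] h;
  by rewrite (connect_trans h (connect1 Ecd)) ?orbT.
have Dend c d : D c -> source d = target c -> D d.
  move=> Dc h; case: (target d =P source c) => h'.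
    by rewrite (_ : d = rev_edge c) ?Drev //; apply: oedge_inj.
  by apply: Dadj Dc; rewrite gadjE h eqxx /= eq_sym; move/eqP: h' => ->.
have Dall u : forall d, source d = u -> D d.
  move: u; apply: (connected_ind (x := target a) connX).
    by move=> d; apply: Dend; rewrite /D connect0.
  by move=> u v uv Du d dv; apply: Dend (Du (oedge uv) _) _.
exact: Dall.
Qed.

Lemma connect_of_rev (c : oriented_edge X) : connect E c (rev_edge c) ->
  forall a b, connect E a b.
Proof.
move=> h; have hc b : connect E c b.
  by case/orP: (connect_or_rev c b) => // /(connect_trans h).
by move=> a b; apply: connect_trans (hc b); rewrite gconnect_sym.
Qed.

Definition has_branching :=
  exists v p q r : X, [/\ adj v p, adj v q & adj v r] /\ [/\ p != q, p != r & q != r].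

(** The chain [pv], [vq], [rv], [vp] leads from an edge to its own reverse. *)
Lemma branching_connect : has_branching -> forall a b, connect E a b.
Proof.
move=> [v [p [q [r [[vp vq vr] [pq pr qr]]]]]].
have pv : adj p v by rewrite adj_sym. have rv : adj r v by rewrite adj_sym.
apply: (@connect_of_rev (oedge pv)).
have -> : rev_edge (oedge pv) = oedge vp by apply: oedge_inj.
apply: (@connect_trans _ _ (oedge vq)).
  by apply: connect1; rewrite gadjE !oedgeE eqxx pq.
by apply: (@connect_trans _ _ (oedge rv)); apply: connect1;
  rewrite gadjE !oedgeE !eqxx /= ?(eq_sym r) ?qr ?pr ?orbT.
Qed.

Lemma degree2_target : ~ has_branching -> forall a b c : oriented_edge X,
  edge_adj a b -> edge_adj a c -> b = c.
Proof.
move=> nb a b c /andP[/eqP sb nb1] /andP[/eqP sc nc1].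
apply: oedge_inj; first by rewrite -sb -sc.
apply/eqP; apply: contra_notT nb => bc.
exists (target a), (source a), (target b), (target c); split; split=> //.
- by rewrite adj_sym oedge_adj.
- by rewrite sb oedge_adj.
- by rewrite sc oedge_adj.
Qed.

Lemma degree2_not_connect : ~ has_branching ->
  forall a : oriented_edge X, ~~ connect E a (rev_edge a).
Proof.
move=> nb a.
apply: (@connect_no_return _ (fun a b => edge_adj a b) (@rev_edge X) (@rev_edgeK X)
  _ _ _ _ _ E id) => //.
- exact: degree2_target.
- by move=> c d; rewrite edge_adj_rev.
- by move=> c d _; apply/eqP/(revl_free rvX).
- move=> c d cd E1; have := revl_far1 rvX c; rewrite -E1.
  by rewrite (revlE rvX) cd.
- by move=> c d /orP; right.
- exact/eqP/(revl_free rvX).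
Qed.
End ConnectOrRev.

(** Edges [a], [b] with a common target and different sources satisfy [edge_adj a (rev_edge b)], so
    their images again have a common target. This makes the vertex map well defined. *)
Lemma induced_map (X Y : sgraph) (phi : oriented_edge X -> oriented_edge Y)
    (a0 : oriented_edge X) :
  connected_graph X ->
  {homo phi : a b / edge_adj a b} ->
  {morph phi : a / rev_edge a} ->
  exists f : X -> Y, forall a,
    source (phi a) = f (source a) /\ target (phi a) = f (target a).
Proof.
move=> connX phiE phiR.
have phiT a b : target a = target b -> target (phi a) = target (phi b).
  move=> h; case: (source a =P source b) => h'.
    by congr (target (phi _)); apply: oedge_inj.
  have: edge_adj a (rev_edge b) by apply/andP; split; [apply/eqP | apply/eqP].
  by move/phiE/andP=> [/eqP ->]; rewrite phiR.
(* The default is taken only at vertices where no edge ends, about which the conclusion says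
   nothing. *)
pose f v := if [pick a | target a == v] is Some a then target (phi a)
            else target (phi a0).
have fT a : target (phi a) = f (target a).
  by rewrite /f; case: pickP => [b /eqP/phiT|/(_ a)/eqP].
by exists f => a; rewrite -fT -target_rev -phiR -[source a]target_rev -fT.
Qed.

Lemma oriented_isomorphic (X Y : sgraph)
    (phi : oriented_edge X -> oriented_edge Y) (a0 : oriented_edge X) :
  connected_graph X -> connected_graph Y -> bijective phi ->
  {mono phi : a b / edge_adj a b} ->
  {morph phi : a / rev_edge a} ->
  isomorphic X Y.
Proof.
move=> connX connY [psi phiK psiK] phiE phiR.
have psiR : {morph psi : a / rev_edge a}.
  by move=> a; apply: (can_inj phiK); rewrite phiR !psiK.
have psiE : {homo psi : a b / edge_adj a b} by move=> a b; rewrite -phiE !psiK.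
have [|f fE] := induced_map a0 connX _ phiR; first by move=> a b; rewrite phiE.
have [g gE] := induced_map (phi a0) connY psiE psiR.
have fK : cancel f g.
  move=> v; have [b <-] := ex_target a0 connX v.
  by have [_ <-] := fE b; have [_ <-] := gE (phi b); rewrite phiK.
have gK : cancel g f.
  move=> v; have [b <-] := ex_target (phi a0) connY v.
  by have [_ <-] := gE b; have [_ <-] := fE (psi b); rewrite psiK.
exists f; split; first by exists g.
move=> x y; apply/idP/idP => [xy|xy].
  have := oedge_adj (psi (oedge xy)).
  by have [-> ->] := gE (oedge xy); rewrite !oedgeE !fK.
have := oedge_adj (phi (oedge xy)).
by have [-> ->] := fE (oedge xy).
Qed.

(** Sides depend only on adjacency and reversal, so [edge_adj] and its pullback along [phi] have the
    same sides and are equal or opposite. In the opposite case [phi] followed by reversal is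
    used. *)
Lemma rev_commuting_isomorphic (X Y : sgraph)
    (phi : oriented_edge X -> oriented_edge Y) (a0 : oriented_edge X) :
  connected_graph X -> connected_graph Y -> bijective phi ->
  {mono phi : a b / gamma_adj a b} ->
  {morph phi : a / rev_edge a} ->
  isomorphic X Y.
Proof.
move=> connX connY phiB phiE phiR.
have rvX := reversal_rev_edge X; have rvY := reversal_rev_edge Y.
have rv' : reversal (@gamma_adj X) (@rev_edge X) (relpre phi (@edge_adj Y)).
  exact: reversal_transport phiB phiE phiR rvY.
have sides a b c : gamma_adj a b -> gamma_adj a c ->
    (edge_adj a b == edge_adj a c) = (edge_adj (phi a) (phi b) == edge_adj (phi a) (phi c)).
  by move=> Eb Ec; rewrite (revl_side rvX Eb Ec) (revl_side rv' Eb Ec).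
have Esym := revl_sym rvX; have Oa := revl_asym rvX; have Oa' := revl_asym rv'.
have edge_gadj (Z : sgraph) (a b : oriented_edge Z) : edge_adj a b -> gamma_adj a b.
  by rewrite /gamma_adj => ->.
case: (orientation_local Oa sides a0) => h.
(* [gamma X] may be disconnected, so the behaviour at [a0] is copied to [rev_edge a0]; together
   these two reach everything. *)
- have hrev b : gamma_adj (rev_edge a0) b ->
      edge_adj (phi (rev_edge a0)) (phi b) = edge_adj (rev_edge a0) b.
    rewrite -[b]rev_edgeK; move: (rev_edge b) => c.
    rewrite (revl_mono rvX) !phiR !edge_adj_rev => Ec.
    by have := Oa' _ _ Ec; rewrite /= => ->; rewrite (Oa _ _ Ec) h.
  have hall a b : gamma_adj a b -> edge_adj (phi a) (phi b) = edge_adj a b.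
    case/orP: (connect_or_rev connX a0 a) => c.
      exact: (orientation_connect Esym Oa Oa' sides c h).
    exact: (orientation_connect Esym Oa Oa' sides c hrev).
  apply: (oriented_isomorphic a0 connX connY phiB _ phiR) => a b.
  case Eab: (gamma_adj a b); first exact: hall.
  move: (Eab) (Eab); rewrite -{1}phiE => E1 E2.
  move/negbT: E1; rewrite negb_or => /andP[/negbTE -> _].
  by move/negbT: E2; rewrite negb_or => /andP[/negbTE -> _].
have hrev b : gamma_adj (rev_edge a0) b ->
    edge_adj (phi (rev_edge a0)) (phi b) = edge_adj b (rev_edge a0).
  rewrite -[b]rev_edgeK; move: (rev_edge b) => c.
    rewrite (revl_mono rvX) !phiR !edge_adj_rev => Ec.
  by have := Oa' _ _ Ec; rewrite /= => ->; rewrite h // (Oa _ _ Ec) negbK.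
have hall a b : gamma_adj a b -> edge_adj (phi a) (phi b) = edge_adj b a.
  case/orP: (connect_or_rev connX a0 a) => c.
    exact: (orientation_connect_opp Esym Oa Oa' sides c h).
  exact: (orientation_connect_opp Esym Oa Oa' sides c hrev).
apply: (@oriented_isomorphic _ _ (fun a => rev_edge (phi a)) a0 connX connY).
- by apply: bij_comp => //; exists (@rev_edge Y); apply: rev_edgeK.
- move=> a b; rewrite edge_adj_rev; case Eab: (gamma_adj a b).
    by rewrite hall // Esym.
  move: (Eab) (Eab); rewrite -{1}phiE => E1 E2.
  move/negbT: E1; rewrite negb_or => /andP[_ /negbTE ->].
  by move/negbT: E2; rewrite negb_or => /andP[/negbTE -> _].
- by move=> a; rewrite phiR.
Qed.

(* A map that is z on a set C and the identity elsewhere can only be an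
   automorphism if C is closed under this relation. *)
Definition tied (T : finType) (E : rel T) (z : T -> T) : rel T :=
  fun a b => (b == z a) || (E a b && ~~ E (z a) b).

Lemma tied_morph (T T' : finType) (E : rel T) (E' : rel T') (z : T -> T)
    (z' : T' -> T') (f : T -> T') : injective f ->
  {mono f : a b / E a b >-> E' a b} -> (forall a, f (z a) = z' (f a)) ->
  forall a b, connect (tied E z) a b -> connect (tied E' z') (f a) (f b).
Proof.
move=> fI fE fz a b /connectP[p]; elim: p a => [|c p IHp] a /=.
  by move=> _ ->.
case/andP=> ac cp Eb; apply: connect_trans (IHp _ cp Eb); apply: connect1.
by move: ac; rewrite /tied -fz (inj_eq fI) !fE.
Qed.

Section Tied.
Variables (T : finType) (E : rel T) (z : T -> T).
Hypotheses (Esym : symmetric E) (zK : involutive z) (zE : {mono z : a b / E a b}).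

Lemma tied_sym : symmetric (tied E z).
Proof.
move=> a b; rewrite /tied eq_sym (inv_eq zK) [E b a]Esym.
by rewrite -[E (z a) b]zE zK [E a (z b)]Esym.
Qed.

Lemma tied_connect_sym : connect_sym (tied E z).
Proof. exact: sym_connect_sym tied_sym. Qed.

Lemma tied_z a : connect (tied E z) a (z a).
Proof. by apply: connect1; rewrite /tied eqxx. Qed.
End Tied.

(** The two disjunctions unfold the adjacency of an edge [(s, t)] to [(sv, u)] and to [(v, su)];
    this is used in [root_far]. *)
Lemma crossing_ends (T : eqType) (s t u v su sv : T) :
  (u == s) && (sv != t) || (t == sv) && (s != u) ->
  (su == s) && (v != t) || (t == v) && (s != su) ->
  sv <> v -> su <> u -> (s = su /\ t = sv) \/ (s = u /\ t = v).
Proof.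
by case/orP=> /andP[/eqP h1 /eqP h2] /orP[]/andP[/eqP h3 /eqP h4] h5 h6;
  first [exfalso; congruence | left; split; congruence | right; split; congruence].
Qed.

(** * Involutions that preserve the directions of edges *)

Section Preserving.
Variables (X : sgraph) (connX : connected_graph X).
Variables (sg : X -> X) (z : oriented_edge X -> oriented_edge X).
Variables (O2 : rel (oriented_edge X)) (a0 : oriented_edge X).
Hypotheses (sgK : involutive sg) (sgE : {mono sg : u v / adj u v}).
Hypotheses (zS : forall a, source (z a) = sg (source a)).
Hypotheses (zT : forall a, target (z a) = sg (target a)).
Hypothesis rv2 : reversal (@gamma_adj X) (fun a => rev_edge (z a)) O2.
Hypotheses (brX : has_branching X) (a0z : z a0 != a0).
Local Notation E := (@gamma_adj X).
Local Notation R2 := (fun a => rev_edge (z a)).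

Lemma pres_far u v : adj u v -> sg u != v.
Proof.
move=> uv; have := revl_free rv2 (oedge uv); rewrite oedge_eq !oedgeE zS zT !oedgeE.
by apply: contra => /eqP <-; rewrite sgK !eqxx.
Qed.

(** At a fixed vertex [v] with neighbour [u], the edge [(u, v)] must not be adjacent to its
    [R2]-image [(v, sg u)], which forces [sg u = u]. Fixed points would spread over all of [X],
    against [a0z]. *)
Lemma pres_move v : sg v != v.
Proof.
apply/eqP => sv; have fixall: forall w, sg w = w.
  apply: (connected_ind connX sv) => {sv}v u vu sv.
  have uv : adj u v by rewrite adj_sym.
  have := revl_far1 rv2 (oedge uv); rewrite gadjE !oedgeE zS zT !oedgeE sv eqxx /=.
  by case/norP=> /negPn/eqP.
by case/eqP: a0z; apply: oedge_inj; rewrite (zS, zT) fixall.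
Qed.

Definition cls v := [set v; sg v].

Lemma cls_eq u v : (cls u == cls v) = (u == v) || (u == sg v).
Proof.
apply/eqP/idP => [h|].
  by have := set21 u (sg u); rewrite -/(cls u) h !inE.
case/orP=> /eqP-> //; apply/setP => w; rewrite !inE sgK orbC //.
Qed.

Lemma cls_sg v : cls (sg v) = cls v.
Proof. by apply/eqP; rewrite cls_eq eqxx orbT. Qed.

Lemma pres_side v x y (vx : adj v x) (vy : adj v y) :
  same_side E R2 (oedge vx) (oedge vy) = (cls x == cls y).
Proof.
rewrite /same_side oedge_eq gadjE !oedgeE zS zT !oedgeE cls_eq.
by rewrite (negbTE (pres_move v)) eqxx eq_sym [v == _]eq_sym (negbTE (pres_move v)) andbT orbF.
Qed.

Lemma pres_side_mixed u v x y (vx : adj v x) (yu : adj y u) :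
  adj u v -> y != v -> cls u != cls x ->
  same_side E R2 (oedge vx) (oedge yu) = (v == sg y).
Proof.
rewrite cls_eq negb_or /same_side oedge_eq gadjE !oedgeE zS zT !oedgeE.
move=> uv /negbTE yv /andP[_ ux]; rewrite [v == y]eq_sym yv /=.
have -> : (x == sg u) = false by rewrite -(inv_eq sgK) eq_sym (negbTE ux).
by rewrite /= (inv_eq sgK u x) ux andbT eq_sym.
Qed.

Lemma gadj_out u v x (uv : adj u v) (vx : adj v x) : u != x ->
  E (oedge uv) (oedge vx).
Proof. by rewrite gadjE !oedgeE eqxx => ->. Qed.

Lemma gadj_in u v y (uv : adj u v) (yu : adj y u) : y != v ->
  E (oedge uv) (oedge yu).
Proof. by rewrite gadjE !oedgeE eqxx => ->; rewrite orbT. Qed.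

(** As seen from [(u, v)], the edge [(w, u)] shares the [R2]-side of [(v, x)] iff [v = sg w], and
    the same condition holds for [(v, y)]. By the pigeonhole it holds, and then [x] and [y] lie in
    one orbit. *)
Lemma pres_leaf v u x y w : adj v u -> adj v x -> adj v y -> adj u w ->
  cls u != cls x -> cls u != cls y -> cls x != cls y -> w = v.
Proof.
move=> vu vx vy uw ux uy xy; apply/eqP; apply: contraTT xy => wv.
have uv : adj u v by rewrite adj_sym. have wu : adj w u by rewrite adj_sym.
have neq s t : cls s != cls t -> s != t by apply: contraNneq => ->.
have Ex := gadj_out uv vx (neq _ _ ux); have Ey := gadj_out uv vy (neq _ _ uy).
have Ew := gadj_in uv wu wv.
have := side_pigeon rv2 Ex Ey Ew; rewrite negbK -(pres_side vx vy).
case/or3P=> //; rewrite pres_side_mixed // => /eqP vw;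
  by apply: (side_trans rv2 Ew Ex Ey); rewrite (side_sym rv2 Ew) // pres_side_mixed // vw.
Qed.

(** With neighbours in three orbits, [v] has no fourth neighbour by the pigeonhole, and the three
    are leaves. So [X] is a star and [sg v] is a neighbour of [v], against [pres_far]. *)
Lemma pres_two_classes v u x y : adj v u -> adj v x -> adj v y ->
  [|| cls u == cls x, cls u == cls y | cls x == cls y].
Proof.
move=> vu vx vy; apply/negPn; apply/negP => /norP[ux /norP[uy xy]].
have nbr w : adj v w -> [|| w == u, w == x | w == y].
  move=> vw; apply/negPn; apply/negP => /norP[wu /norP[wx wy]].
  have wv : adj w v by rewrite adj_sym.
  have := side_pigeon rv2 (gadj_out wv vu wu) (gadj_out wv vx wx) (gadj_out wv vy wy).
  by rewrite !pres_side (negbTE ux) (negbTE uy) (negbTE xy).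
have all4 : forall w, (w == v) || adj v w.
  apply: (connected_ind (x := v) connX); rewrite ?eqxx // => s t st.
  case/orP=> [/eqP sv|/nbr/or3P[] /eqP sv]; first by rewrite -sv st orbT.
  - by move: st; rewrite sv => /(pres_leaf vu vx vy) ->; rewrite ?eqxx.
  - by move: st; rewrite sv => /(pres_leaf vx vu vy) ->; rewrite ?eqxx // eq_sym.
  by move: st; rewrite sv => /(pres_leaf vy vu vx) ->; rewrite ?eqxx // eq_sym.
have := all4 (sg v); rewrite (negbTE (pres_move v)) /= => vsv.
by have := pres_far vsv; rewrite eqxx.
Qed.
(** The image of an oriented edge in the quotient of [X] by [sg]. *)
Definition link a := (cls (source a), cls (target a)).

Lemma link_z a : link (z a) = link a.
Proof. by rewrite /link zS zT !cls_sg. Qed.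

Definition link_step (L L' : {set X} * {set X}) : Prop :=
  exists a b, [/\ L = link a, L' = link b, L.2 = L'.1 & L.1 <> L'.2].

Lemma link_lift v b : cls (source b) = cls v ->
  exists2 x, adj v x & cls x = cls (target b).
Proof.
move/eqP; rewrite cls_eq => /orP[] /eqP sb.
  by exists (target b); rewrite // -sb oedge_adj.
by exists (sg (target b)); rewrite ?cls_sg // -(sgK v) sgE -sb oedge_adj.
Qed.

(** Vertices of the quotient have degree at most 2 by [pres_two_classes], so walks without
    backtracking are deterministic there. *)
Lemma link_step_fun L L1 L2 : link_step L L1 -> link_step L L2 -> L1 = L2.
Proof.
case=> a [b [-> -> /= /esym tb nb]] [a' [c [[ss tt] -> /= /esym tc nc]]].
have [x vx xb] := link_lift tb; have [y vy yc] := link_lift tc.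
have va : adj (target a) (source a) by rewrite adj_sym oedge_adj.
have := pres_two_classes va vx vy; rewrite xb yc.
by case/or3P=> /eqP // h; rewrite /link tb tc h.
Qed.

Lemma cls_source_target a : cls (source a) <> cls (target a).
Proof.
apply/eqP; rewrite cls_eq (negbTE (source_neq_target a)) /=.
by rewrite -(inv_eq sgK) pres_far // oedge_adj.
Qed.

Lemma pres_z_mono : {mono z : a b / E a b}.
Proof. by move=> a b; rewrite !gadjE !zS !zT !(inj_eq (inv_inj sgK)). Qed.

Lemma pres_zK : involutive z.
Proof. by move=> a; apply: oedge_inj; rewrite !(zS, zT) sgK. Qed.

Lemma pres_cross u v x (uv : adj u v) (vx : adj v x) : u != x ->
  E (z (oedge uv)) (oedge vx) = (x == sg u).
Proof.
move=> ux; rewrite gadjE !(zS, zT) !oedgeE (negbTE (pres_move v)) /=.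
by rewrite eq_sym [v == _]eq_sym (pres_move v) andbT eq_sym.
Qed.

Lemma untwisted_link_step a b :
  edge_adj a b -> ~~ E (z a) b -> link_step (link a) (link b).
Proof.
move=> /andP[/eqP ab nab] nE; exists a, b; split=> //=; first by rewrite ab.
move/eqP; rewrite cls_eq (negbTE nab) /= => /eqP h; move: nE.
rewrite gadjE !(zS, zT) h sgK eqxx -ab [target a == _]eq_sym.
by rewrite (pres_move (target a)) orbT.
Qed.

(** A tie either applies [z], which keeps the link, or moves along the quotient without turning
    back; hence [connect_no_return] applies to the labels [link]. *)
Lemma pres_not_tied a : ~~ connect (tied E z) a (rev_edge a).
Proof.
apply: (@connect_no_return _ link_step (fun L => (L.2, L.1)) _ _ _ _ _ _ _ link) => //.
- by case.
- exact: link_step_fun.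
- move=> L L' [c [d [-> -> h nh]]]; exists (rev_edge d), (rev_edge c).
  by split=> //; apply/nesym.
- by move=> L L' [c [d [-> _ _ _]]] [/esym/cls_source_target].
- by move=> L L' [c [d [-> -> /= h nh]]] [_ /esym].
- move=> c d; rewrite /tied => /orP[/eqP->|]; first by left; rewrite link_z.
  case/andP=> /orP[] cd nE; right; [left | right]; apply: untwisted_link_step => //.
  by rewrite -pres_z_mono pres_zK (revl_sym rv2).
- by case=> /esym/cls_source_target.
Qed.
Lemma pres_z_rev : {morph z : a / rev_edge a}.
Proof. by move=> a; apply: oedge_inj; rewrite ?oedgeE !(zS, zT). Qed.

Let tiedC : connect_sym (tied E z).
Proof. exact: tied_connect_sym (revl_sym rv2) pres_zK pres_z_mono. Qed.

Lemma tied_rev a b : connect (tied E z) a b ->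
  connect (tied E z) (rev_edge a) (rev_edge b).
Proof.
apply: tied_morph; first exact: inv_inj (@rev_edgeK X).
  exact: revl_mono (reversal_rev_edge X).
by move=> c; rewrite pres_z_rev.
Qed.

Lemma tied_next u v x (uv : adj u v) (vx : adj v x) : cls x != cls u ->
  connect (tied E z) (oedge uv) (oedge vx).
Proof.
rewrite cls_eq negb_or => /andP[xu xsu]; apply: connect1; rewrite /tied.
by rewrite gadj_out 1?eq_sym // pres_cross 1?eq_sym // xsu orbT.
Qed.

(** Both edges are tied to a common successor out of [v] or, up to [z], to a common predecessor into
    [u]. If neither exists, the neighbours of each vertex lie in one orbit, which excludes
    branching. *)
Lemma tied_twin u v (uv : adj u v) (suv : adj (sg u) v) :
  connect (tied E z) (oedge uv) (oedge suv).
Proof.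
case: (pickP [pred x | adj v x & cls x != cls u]) => [x /= /andP[vx xu]|nox].
  apply: (connect_trans (tied_next uv vx xu)); rewrite tiedC.
  by apply: tied_next; rewrite cls_sg.
case: (pickP [pred y | adj u y & cls y != cls v]) => [y /= /andP[uy yv]|noy].
  have yu : adj y u by rewrite adj_sym.
  have usv : adj u (sg v) by rewrite -(sgK u) sgE.
  have -> : oedge suv = z (oedge usv).
    by apply: oedge_inj; rewrite (zS, zT) !oedgeE ?sgK.
  apply: (connect_trans _ (tied_z E z (oedge usv))).
  apply: (@connect_trans _ _ (oedge yu)).
    by rewrite tiedC; apply: tied_next; rewrite eq_sym.
  by apply: tied_next; rewrite cls_sg eq_sym.
have cls_nbr s : (cls s == cls u) || (cls s == cls v) ->
    exists2 w, (cls w == cls u) || (cls w == cls v) &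
      forall t, adj s t -> cls t == cls w.
  case/orP; rewrite cls_eq => hs; [exists v|exists u];
    rewrite ?eqxx ?orbT // => t st; apply/negPn; apply/negP => nt.
    case/orP: hs st => /eqP->; first by move=> ut; have /andP[] := noy t.
    rewrite -(sgK t) sgE => ut; have /andP[] := noy (sg t).
    by rewrite cls_sg.
  case/orP: hs st => /eqP->; first by move=> vt; have /andP[] := nox t.
  rewrite -(sgK t) sgE => vt; have /andP[] := nox (sg t).
  by rewrite cls_sg.
case: brX => v0 [p [q [r [[vp vq vr] [pq pr qr]]]]].
have /(_ v0)/cls_nbr [w _ hw] : forall s, (cls s == cls u) || (cls s == cls v).
  apply: (connected_ind (x := u) connX); first by rewrite eqxx.
  by move=> s t st /cls_nbr [w hw /(_ t st)/eqP ->].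
have: cls p == cls q by rewrite (eqP (hw _ vp)) eq_sym hw.
have: cls p == cls r by rewrite (eqP (hw _ vp)) eq_sym hw.
rewrite !cls_eq (negbTE pq) (negbTE pr) /= => /eqP pr' /eqP pq'.
by case/eqP: qr; apply: (inv_inj sgK); rewrite -pq' -pr'.
Qed.

(** Adjacent edges not tied directly are, up to reversing both, an edge and the reverse of its twin.
    So ties and reversals together follow every path in [gamma X]. *)
Lemma pres_tied_cover a b :
  connect (tied E z) a b || connect (tied E z) (rev_edge a) b.
Proof.
pose D c := connect (tied E z) a c || connect (tied E z) (rev_edge a) c.
have Dt c d : connect (tied E z) c d -> D c -> D d.
  by move=> cd /orP[] h; apply/orP; [left|right]; apply: connect_trans h cd.
have Dr c : D c -> D (rev_edge c).
  by case/orP=> /tied_rev; rewrite /D ?rev_edgeK => ->; rewrite ?orbT.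
have Dnext c d : edge_adj c d -> D c -> D d.
  move=> cd Dc; case Ez: (E (z c) d); last first.
    by apply: Dt (connect1 _) Dc; rewrite /tied Ez /gamma_adj cd orbT.
  case/andP: cd => [/eqP h nh].
  have uv := oedge_adj c; have vx : adj (target c) (target d) by rewrite h oedge_adj.
  have [Ec Ed] : c = oedge uv /\ d = oedge vx by split; apply: oedge_inj.
  move: Ez; rewrite Ec Ed pres_cross // => /eqP tE.
  have suv : adj (sg (source c)) (target c) by rewrite -tE adj_sym.
  rewrite (_ : oedge vx = rev_edge (oedge suv)); last by apply: oedge_inj; rewrite ?oedgeE.
  by apply: Dr; apply: Dt (tied_twin uv suv) _; rewrite -Ec.
have Dadj c d : E c d -> D c -> D d.
  case/orP; first exact: Dnext.
  rewrite -edge_adj_rev => h /Dr/(Dnext _ _ h)/Dr; by rewrite rev_edgeK.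
have walk p c : D c -> path E c p -> D (last c p).
  by elim: p c => [|d p IHp] c //= /Dadj Dc /andP[/Dc/IHp].
have /connectP[p ap ->] := branching_connect connX brX a b.
by apply: walk ap; rewrite /D connect0.
Qed.
(** Otherwise [b] is the reverse of the twin of [a], and this twin would be tied to its own
    reverse. *)
Lemma tied_not_cross a b : edge_adj a b -> connect (tied E z) a b ->
  target b != sg (source a).
Proof.
move=> /andP[/eqP ab nab] cab; apply/eqP => tb.
have uv := oedge_adj a; have suv : adj (sg (source a)) (target a).
  by rewrite -tb ab adj_sym oedge_adj.
have Ea : a = oedge uv by apply: oedge_inj.
have Eb : b = rev_edge (oedge suv) by apply: oedge_inj; rewrite ?oedgeE.
case/negP: (pres_not_tied (oedge suv)); rewrite -Eb; apply: connect_trans cab.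
by rewrite tiedC; move: (tied_twin uv suv); rewrite -Ea.
Qed.

Lemma pres_z_free a : z a != a.
Proof. by rewrite oedge_eq zS negb_and pres_move. Qed.

(* w is a square root of z such that rev_edge \o w is a reversal too. *)
Section Root.
Variables (w : oriented_edge X -> oriented_edge X) (O3 : rel (oriented_edge X)).
Hypotheses (wE : {mono w : a b / E a b}) (wz : forall a, w (w a) = z a).
Hypothesis wr : forall a, w (rev_edge (w a)) = rev_edge a.
Hypothesis rv3 : reversal E (fun a => rev_edge (w a)) O3.
Hypothesis nt3 : forall a, ~~ connect (tied E z) a (rev_edge (w a)).

Lemma root_z a : w (z a) = z (w a). Proof. by rewrite -!wz. Qed.

Lemma root_rev a : w (rev_edge a) = rev_edge (z (w a)).
Proof. by rewrite -[in LHS](pres_zK a) -wz wr root_z. Qed.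

Lemma root_tied a : connect (tied E z) a (w a).
Proof.
case/orP: (pres_tied_cover a (rev_edge (w a))) => [h|/tied_rev].
  by case/negP: (nt3 a).
by rewrite !rev_edgeK.
Qed.

Section Core.
Variables (u v x : X) (uv : adj u v) (suv : adj (sg u) v) (vx : adj v x).
Hypothesis xu : cls x != cls u.
Local Notation e := (oedge uv).
Local Notation h := (oedge suv).
Local Notation n := (oedge vx).

(* Otherwise w turns a blow-up of a 4-cycle by half a turn, and then n and
   z (w n), which lie at opposite ends of e, are both at the end of rev_edge h
   with respect to the reversal rev_edge \o w. *)
Lemma root_not_adj : ~~ E (w n) h.
Proof.
apply/negP => Ewnh.
have svv := pres_move v. have suu := pres_move u. have sxx := pres_move x.
have [xnu xnsu] : x != u /\ x != sg u by apply/norP; rewrite -cls_eq.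
have cen : connect (tied E z) e n by apply: tied_next.
have ceh : connect (tied E z) e h by apply: tied_twin.
have chn : connect (tied E z) h n by apply: connect_trans cen; rewrite tiedC.
have chw b : connect (tied E z) h b -> connect (tied E z) h (w b).
  by move=> hb; apply: connect_trans hb (root_tied b).
have vsu : adj v (sg u) by rewrite adj_sym.
have vu : adj v u by rewrite adj_sym.
have [m Em] : exists m, m = w n by exists (w n).
have [k Ek] : exists k, k = w h by exists (w h).
rewrite -Em in Ewnh.
have chm : connect (tied E z) h m by rewrite Em; apply: chw.
have chk : connect (tied E z) h k by rewrite Ek; apply: chw.
(* Either [m] starts at [v] or it ends at [sg u]. In the first case it ends outside [cls u], hence
   at [x] or [sg x]: the former gives [w n = n], the latter makes [n] adjacent to
   [rev_edge (w n)]. *)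
have [mT mS mS'] : [/\ target m = sg u, source m != v & source m != sg v].
  move: (Ewnh); rewrite (revl_sym rv2) => /orP[] Eh.
    have := tied_not_cross Eh chm; rewrite !oedgeE sgK => nu.
    case/andP: Eh; rewrite !oedgeE => /eqP sm nsu.
    have vt : adj v (target m) by rewrite sm oedge_adj.
    have := pres_two_classes vu vx vt; rewrite eq_sym (negbTE xu) /=.
    case/orP; rewrite cls_eq => /orP[] /eqP h1.
    - by rewrite -h1 eqxx in nu.
    - by rewrite h1 sgK eqxx in nsu.
    - have wn : w n = n by rewrite -Em; apply: oedge_inj.
      by have := pres_z_free n; rewrite -wz !wn eqxx.
    have := revl_far1 rv3 n; rewrite -Em gadjE !oedgeE -sm eqxx /=.
    by rewrite -[target m]sgK -h1 sxx orbT.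
  have chm' := chm; rewrite tiedC in chm'.
  have := tied_not_cross Eh chm'; case/andP: Eh; rewrite !oedgeE.
  move=> /eqP -> nv nsv; split=> //.
  by rewrite -(inv_eq sgK) eq_sym.
have Ewmk : E m k by rewrite Em Ek wE (revl_sym rv2); apply: gadj_out; rewrite // eq_sym.
(* If [k] started at [sg u], the bound of two orbits among the neighbours of [sg u] would leave only
   [k = h] and [k = z e], both excluded. *)
have kT : target k = source m.
  case/orP: (Ewmk) => /andP[/eqP h1 h2] //.
  have ckm : connect (tied E z) m k.
    by apply: connect_trans chk; rewrite tiedC.
  have suT : adj (sg u) (target k) by rewrite -mT h1 oedge_adj.
  have suS : adj (sg u) (source m) by rewrite -mT adj_sym oedge_adj.
  have Emk : edge_adj m k by rewrite /edge_adj h1 eqxx.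
  have := tied_not_cross Emk ckm => nk.
  have := pres_two_classes suv suS suT.
  rewrite [cls v == cls (source m)]eq_sym !cls_eq (negbTE mS) (negbTE mS') /=.
  rewrite (negbTE h2) -(inv_eq sgK (source m)) [sg (source m) == _]eq_sym (negbTE nk) /= orbF.
  case/orP=> /eqP h3.
    have Ekh : k = h by apply: oedge_inj; rewrite ?oedgeE -?h1 -?h3.
    by have := pres_z_free h; rewrite -wz -Ek Ekh -Ek Ekh eqxx.
  have Ekz : k = z (oedge uv).
    by apply: oedge_inj; rewrite (zS, zT) ?oedgeE -?h1 // h3 sgK.
  have := revl_far1 rv3 h.
  by rewrite -Ek Ekz gadjE !oedgeE zS zT !oedgeE eqxx svv orbT.
have kS : source k = sg x.
  have : E (z n) k by rewrite -wz -Em Ek wE.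
  rewrite gadjE zS zT !oedgeE kT => /orP[/andP[/eqP->//]|/andP[]].
  by rewrite (negbTE mS').
have Rf : rev_edge (w (rev_edge h)) = z k by rewrite root_rev rev_edgeK Ek.
have Een : E e n by apply: gadj_out; rewrite eq_sym.
have Eef : E e (rev_edge h) by rewrite gadjE !oedgeE eqxx [u == _]eq_sym suu.
have Eep : E e (z m).
  rewrite gadjE !zS !zT !oedgeE mT sgK eqxx.
  by rewrite [sg _ == v](inv_eq sgK) mS' orbT.
have vm : v != sg (source m) by rewrite -(inv_eq sgK) eq_sym.
have side1 : same_side E (fun a => rev_edge (w a)) (rev_edge h) n.
  rewrite (side_sym rv3 Eef Een) /same_side Rf gadjE !(zS, zT) !oedgeE kS kT sgK eqxx.
  by rewrite vm orbT.
have side2 : same_side E (fun a => rev_edge (w a)) (rev_edge h) (z m).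
  by rewrite (side_sym rv3 Eef Eep) /same_side Rf pres_z_mono Ewmk orbT.
have := side_trans rv3 Eef Een Eep side1 side2.
rewrite /same_side oedge_eq zS oedgeE (negbTE vm) /=.
have -> : rev_edge (w (z m)) = rev_edge n by rewrite root_z Em wz pres_zK.
by have := revl_far1 (reversal_rev_edge X) n => /negbTE ->.
Qed.
End Core.

(** As seen from [e], for the reversal [rev_edge \o w], the assumptions separate [n] from both
    [rev_edge h] and [z (rev_edge h)], so these two share a side. This leaves [e] and [z e] for
    [w h], and both make [h] adjacent to [rev_edge (w h)]. *)
Lemma root_far u v x (uv : adj u v) (suv : adj (sg u) v) (vx : adj v x) :
  cls x != cls u -> ~~ E (w (oedge vx)) (oedge suv) ->
  ~~ E (w (z (oedge vx))) (oedge suv) -> False.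
Proof.
move=> xu; set e := oedge uv; set h := oedge suv; set n := oedge vx => far1 far2.
have svv := pres_move v; have suu := pres_move u.
have ceh : connect (tied E z) e h by apply: tied_twin.
have Een : E e n by move: xu; rewrite cls_eq => /norP[xu _]; apply: gadj_out; rewrite eq_sym.
have Eef : E e (rev_edge h) by rewrite gadjE !oedgeE eqxx [u == _]eq_sym suu.
have Eezf : E e (z (rev_edge h)).
  by rewrite gadjE zS zT !oedgeE sgK eqxx [v == _]eq_sym svv ?orbT.
have Rzf : rev_edge (w (z (rev_edge h))) = w h.
  by rewrite root_z root_rev -pres_z_rev rev_edgeK pres_zK.
have Rf : rev_edge (w (rev_edge h)) = z (w h) by rewrite root_rev rev_edgeK.
have := side_pigeon rv3 Eef Eezf Een.
rewrite (side_sym rv3 Eef Een) (side_sym rv3 Eezf Een) /same_side Rf Rzf.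
have nf : (n == rev_edge h) = false.
  apply/negbTE; rewrite oedge_eq !oedgeE eqxx /=; apply: contraNneq xu => ->.
  by rewrite cls_sg.
have nzf : (n == z (rev_edge h)) = false.
  by apply/negbTE; rewrite oedge_eq zS !oedgeE eq_sym (negbTE svv).
rewrite nf nzf [_ == z _]eq_sym (negbTE (pres_z_free _)) /=.
have -> : E n (z (w h)) = false.
  by apply/negbTE; rewrite -wE root_z wz pres_zK.
have -> : E n (w h) = false.
  by apply/negbTE; rewrite -wE wz -pres_z_mono pres_zK -root_z.
rewrite !orbF => Efwh.
have: w h = z e \/ w h = e.
  (* Without this adjacency [rev_edge h] would be tied to [w h], hence to [h]. *)
  have ncf : E (z (rev_edge h)) (w h).
    apply/negPn; apply/negP => nE; case/negP: (pres_not_tied h).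
    apply: connect_trans (root_tied h) _; rewrite tiedC; apply: connect1.
    by rewrite /tied Efwh nE orbT.
  move: ncf Efwh; rewrite !gadjE !(zS, zT) !oedgeE !sgK.
  move/eqP: svv => svv'; move/eqP: suu => suu'.
  move=> F1 F2; case: (crossing_ends F1 F2 svv' suu') => -[hs ht]; [left | right];
    by apply: oedge_inj; rewrite ?(zS, zT).
case=> Ewh.
  have := revl_far1 rv3 h; rewrite Ewh gadjE !oedgeE zS zT !oedgeE eqxx svv.
  by rewrite orbT.
have := revl_far1 rv3 h; rewrite Ewh gadjE !oedgeE eqxx.
by rewrite suu.
Qed.
End Root.

Lemma branching_link : exists v u x : X,
  [/\ adj v u, adj v (sg u), adj v x & cls x != cls u].
Proof.
case: brX => v [p [q [r [[vp vq vr] [pq pr qr]]]]].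
have h s t o : adj v s -> adj v t -> adj v o -> s != t -> s != o -> t != o ->
    cls s == cls t -> exists v u x : X,
    [/\ adj v u, adj v (sg u), adj v x & cls x != cls u].
  rewrite cls_eq => vs vt vo st so to; rewrite (negbTE st) /= => /eqP Es.
  exists v, s, o; split=> //; first by rewrite Es sgK.
  have st' : sg s = t by rewrite Es sgK.
  by rewrite cls_eq st' (eq_sym o s) (eq_sym o t) (negbTE so) (negbTE to).
case/or3P: (pres_two_classes vp vq vr); first exact: (h p q r).
- by apply: (h p r q) => //; rewrite eq_sym.
- by apply: (h q r p) => //; rewrite eq_sym.
Qed.

(** Both [w] and [w \o z] are square roots of [z]; [root_not_adj] for each of them supplies one of
    the two assumptions of [root_far]. *)
Lemma pres_no_root (w : oriented_edge X -> oriented_edge X)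
    (O3 O4 : rel (oriented_edge X)) :
  {mono w : a b / E a b} -> (forall a, w (w a) = z a) ->
  (forall a, w (rev_edge (w a)) = rev_edge a) ->
  reversal E (fun a => rev_edge (w a)) O3 ->
  reversal E (fun a => rev_edge (w (z a))) O4 ->
  (forall a, ~~ connect (tied E z) a (rev_edge (w a))) -> False.
Proof.
move=> wE wz wr rv3 rv4 nt3.
have wzz a : w (z a) = z (w a) by rewrite -!wz.
have [v [u [x [vu vsu vx xu]]]] := branching_link.
have uv : adj u v by rewrite adj_sym. have suv : adj (sg u) v by rewrite adj_sym.
apply: (root_far wE wz wr rv3 nt3 uv (suv := suv) (vx := vx) xu).
  exact: (root_not_adj wE wz wr rv3 nt3 uv).
apply: (root_not_adj (w := fun a => w (z a)) _ _ _ rv4 _ uv) => //.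
- by move=> a b; rewrite wE pres_z_mono.
- by move=> a; rewrite !wzz pres_zK wz.
- by move=> a; rewrite !wzz -pres_z_rev wzz pres_zK wr.
- move=> a; apply: contra (nt3 a) => h; apply: connect_trans h _.
  by rewrite tiedC wzz -pres_z_rev; apply: tied_z.
Qed.
End Preserving.

(** * Involutions that reverse the directions of edges *)

Definition three_nbrs (X : sgraph) (v p q r : X) :=
  [&& adj v p, adj v q, adj v r, p != q, p != r & q != r].

(* The index (false, false) is a corner of the cube, the other three are its
   neighbours; the first component of a vertex tells it from its antipode. The
   edge between i and the antipode of j is kept according to the value of l at
   the third index, which is the sum of i and j. *)
Definition cube_index : finType := (bool * bool)%type.
Definition cube_vertex : finType := (bool * cube_index)%type.

Definition index_xor (i j : cube_index) : cube_index := (i.1 (+) j.1, i.2 (+) j.2).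

Definition cube_adj (l : cube_index -> bool) (p q : cube_vertex) : bool :=
  let o : cube_index := (false, false) in
  if p.1 == q.1 then (p.2 == o) != (q.2 == o)
  else [&& p.2 != o, q.2 != o, p.2 != q.2 & l (index_xor p.2 q.2)].

Definition cube_like (X : sgraph) (l : cube_index -> bool) : Prop :=
  exists2 g : cube_vertex -> X, bijective g &
    forall p q, adj (g p) (g q) = cube_adj l p q.

Section Reversing.
Variables (X : sgraph) (connX : connected_graph X).
Variables (sg : X -> X) (z : oriented_edge X -> oriented_edge X).
Variables (O2 : rel (oriented_edge X)).
Hypotheses (sgK : involutive sg) (sgE : {mono sg : u v / adj u v}).
Hypotheses (zS : forall a, source (z a) = sg (target a)).
Hypotheses (zT : forall a, target (z a) = sg (source a)).
Hypothesis rv2 : reversal (@gamma_adj X) (fun a => rev_edge (z a)) O2.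
Hypothesis brX : has_branching X.
Local Notation E := (@gamma_adj X).
Local Notation R2 := (fun a => rev_edge (z a)).
Local Notation rvX := (reversal_rev_edge X).

Let sgI : injective sg. Proof. exact: inv_inj. Qed.

(** Here [R2] maps [(u, v)] to [(sg u, v)], which by [revl_far2] is not adjacent to [(v, x)]; this
    happens only for [x = sg u]. *)
Lemma rvs_fixed_nbr v u x : sg v = v -> adj v u -> adj v x -> u != x -> x = sg u.
Proof.
move=> sv vu vx ux; have uv : adj u v by rewrite adj_sym.
have := revl_far2 rv2 (gadj_out uv vx ux).
rewrite gadjE !oedgeE zS zT !oedgeE sv eqxx /= negb_or => /andP[/negPn/eqP ->] //.
Qed.

Lemma rvs_moved_nbr v u : sg v != v -> sg u != u -> adj v u -> adj v (sg u) -> False.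
Proof.
move=> sv su vu vsu; have uv : adj u v by rewrite adj_sym.
have usu : u != sg u by rewrite eq_sym.
have := revl_far2 rv2 (gadj_out uv vsu usu).
by rewrite gadjE !oedgeE zS zT !oedgeE eqxx [v == _]eq_sym sv orbT.
Qed.

Lemma three_moved (v p q r : X) : three_nbrs v p q r -> sg v != v.
Proof.
case/and5P=> vp vq vr pq /andP[pr qr]; apply/eqP => sv.
have := rvs_fixed_nbr sv vp vr pr; have := rvs_fixed_nbr sv vp vq pq.
by move=> <- h; rewrite h eqxx in qr.
Qed.

Lemma rvs_side_out (v x y : X) (vx : adj v x) (vy : adj v y) :
  same_side E R2 (oedge vx) (oedge vy) =
  (x == y) || ((x == sg v) (+) (y == sg v)).
Proof.
rewrite /same_side oedge_eq gadjE !oedgeE zS zT !oedgeE eqxx /=.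
rewrite [v == sg y]eq_sym (inv_eq sgK y) [sg v == x]eq_sym.
by case: (x =P y) => [->|_] //=; case: (x == sg v); case: (y == sg v).
Qed.

Lemma rvs_side_in (u x y : X) (xu : adj x u) (yu : adj y u) :
  same_side E R2 (oedge xu) (oedge yu) =
  (x == y) || ((x == sg u) (+) (y == sg u)).
Proof.
rewrite /same_side oedge_eq gadjE !oedgeE zS zT !oedgeE eqxx andbT /=.
rewrite [u == sg y]eq_sym (inv_eq sgK y) [sg u == x]eq_sym.
by case: (x =P y) => [->|_] //=; case: (x == sg u); case: (y == sg u).
Qed.

Lemma rvs_side_mixed (u v x y : X) (vx : adj v x) (yu : adj y u) : adj u v ->
  u != x -> same_side E R2 (oedge vx) (oedge yu) = (x == sg y) (+) (v == sg u).
Proof.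
move=> uv /negbTE ux; rewrite /same_side oedge_eq gadjE !oedgeE zS zT !oedgeE.
rewrite [x == u]eq_sym ux andbF /= [sg u == v]eq_sym [sg y == x]eq_sym.
by case: (x == sg y); case: (v == sg u).
Qed.

Lemma rvs_three (v u x y t : X) : adj v u -> adj v x -> adj v y -> adj v t ->
  u != x -> u != y -> u != t -> x != y -> x != t -> y != t ->
  [|| x == sg v, y == sg v | t == sg v].
Proof.
move=> vu vx vy vt ux uy ut xy xt yt; have uv : adj u v by rewrite adj_sym.
have := side_pigeon rv2 (gadj_out uv vx ux) (gadj_out uv vy uy) (gadj_out uv vt ut).
rewrite !rvs_side_out (negbTE xy) (negbTE xt) (negbTE yt).
by case: (x == _); case: (y == _); case: (t == _).
Qed.

(** Using [rvs_three] without [u], and then without the neighbour found to be [sg v], gives two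
    different neighbours equal to [sg v]. *)
Lemma rvs_no_four (v u x y t : X) : adj v u -> adj v x -> adj v y -> adj v t ->
  u != x -> u != y -> u != t -> x != y -> x != t -> y != t -> False.
Proof.
move=> vu vx vy vt ux uy ut xy xt yt.
have neq (s : X) : adj v s -> forall p q r, adj v p -> adj v q -> adj v r ->
    s != p -> s != q -> s != r -> p != q -> p != r -> q != r -> s <> sg v.
  move=> vs p q r vp vq vr sp sq sr pq pr qr Es.
  have := rvs_three vs vp vq vr sp sq sr pq pr qr.
  by rewrite -Es ![_ == s]eq_sym (negbTE sp) (negbTE sq) (negbTE sr).
have := rvs_three vu vx vy vt ux uy ut xy xt yt; case/or3P=> /eqP.
- by apply: (neq x vx u y t) => //; rewrite eq_sym.
- by apply: (neq y vy u x t) => //; rewrite eq_sym.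
- by apply: (neq t vt u x y) => //; rewrite eq_sym.
Qed.

Definition flipped (a : oriented_edge X) := target a == sg (source a).

Lemma rvs_zK : involutive z.
Proof. by move=> a; apply: oedge_inj; rewrite ?(zS, zT) sgK. Qed.

Lemma rvs_z_rev : {morph z : a / rev_edge a}.
Proof. by move=> a; apply: oedge_inj; rewrite ?oedgeE !(zS, zT). Qed.

Lemma rvs_z_edge a b : edge_adj (z a) (z b) = edge_adj b a.
Proof.
by rewrite /edge_adj !zS !zT !(inj_eq sgI) (eq_sym (source a)) (eq_sym (target a)).
Qed.

Lemma rvs_z_mono : {mono z : a b / E a b}.
Proof. by move=> a b; rewrite /gamma_adj !rvs_z_edge orbC. Qed.

Lemma z_flipped a : (z a == a) = flipped a.
Proof.
rewrite oedge_eq zS zT /flipped (inv_eq sgK) [sg (source a) == _]eq_sym.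
exact: andbb.
Qed.

Lemma flipped_rev a : flipped (rev_edge a) = flipped a.
Proof. by rewrite -!z_flipped rvs_z_rev (inv_eq (@rev_edgeK X)) rev_edgeK. Qed.

Lemma flipped_z a : flipped (z a) = flipped a.
Proof. by rewrite -!z_flipped rvs_zK eq_sym. Qed.

(** This determines the ties: adjacent unflipped edges are tied, while an adjacency between a
    flipped and an unflipped edge gives no tie. *)
Lemma rvs_cross a b : E a b -> E (z a) b = flipped a (+) flipped b.
Proof.
have h c d : edge_adj c d -> E (z c) d = flipped c (+) flipped d.
  case/andP=> /eqP cd nb; rewrite gadjE zS zT /flipped cd [sg (source c) == _]eq_sym.
  case: (source d =P sg (source c)) => [E1|_];
    case: (target d =P sg (source d)) => [E2|/eqP n2] //=.
    by move: nb; rewrite E2 E1 sgK eqxx.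
  by rewrite eq_sym n2.
case/orP; first exact: h.
rewrite -edge_adj_rev => /h; rewrite rvs_z_rev (revl_mono rvX) !flipped_rev.
by [].
Qed.

Lemma flipped_indep a b : E a b -> flipped a -> ~~ flipped b.
Proof.
move=> Eab Fa; apply/negP => Fb; have := rvs_cross Eab; rewrite Fa Fb.
by move: Fa; rewrite -z_flipped => /eqP->; rewrite Eab.
Qed.

Lemma tied_unflipped a b : E a b -> ~~ flipped a -> ~~ flipped b ->
  connect (tied E z) a b.
Proof.
move=> Eab /negbTE Fa /negbTE Fb; apply: connect1.
by rewrite /tied Eab rvs_cross // Fa Fb orbT.
Qed.

(** * A branching vertex not joined to its image: subgraphs of the cube *)

Section Cube.
Variables (v a b c : X).
Hypotheses (vabc : three_nbrs v a b c) (vsv : ~~ adj v (sg v)).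

(** As seen from [(p, v)], the edges to [q] and [r] are on different [R2]-sides, since neither is
    [sg v]. So [(y, p)] shares a side with one of them, that is, [q = sg y] or [r = sg y]. *)
Lemma cube_three p q r y : three_nbrs v p q r -> adj p y ->
  [|| y == v, y == sg q | y == sg r].
Proof.
move=> /and5P[vp vq vr pq /andP[pr qr]] py; case: (y =P v) => //= /eqP yv.
have pv : adj p v by rewrite adj_sym. have yp : adj y p by rewrite adj_sym.
have := side_pigeon rv2 (gadj_out pv vq pq) (gadj_out pv vr pr) (gadj_in pv yp yv).
have vsp : (v == sg p) = false.
  by apply: contraNF vsv => /eqP Ev; rewrite {2}Ev sgK.
rewrite rvs_side_out !rvs_side_mixed // vsp !addbF (negbTE qr).
have nsv (t : X) : adj v t -> (t == sg v) = false.
  by move=> vt; apply: contraNF vsv => /eqP <-.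
by rewrite !nsv //= -(inv_eq sgK q) -(inv_eq sgK r) ![sg _ == y]eq_sym.
Qed.

Let vP : three_nbrs v b a c /\ three_nbrs v c a b.
Proof.
by case/and5P: vabc => va vb vc ab /andP[ac bc];
  rewrite /three_nbrs va vb vc ac bc ab ![_ == a]eq_sym [c == b]eq_sym ab ac bc.
Qed.

Definition corner (i : cube_index) : X :=
  match i with
  | (false, false) => v | (false, true) => a | (true, false) => b | _ => c
  end.

Definition cube_point (p : cube_vertex) : X :=
  if p.1 then sg (corner p.2) else corner p.2.

Definition cube_link (k : cube_index) : bool :=
  match k with
  | (false, true) => adj b (sg c) | (true, false) => adj a (sg c) | _ => adj a (sg b)
  end.

Lemma corner_inj : injective corner.
Proof.
case/and5P: vabc => /adj_neq/eqP va /adj_neq/eqP vb /adj_neq/eqP vc.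
move=> /eqP ab /andP[/eqP ac /eqP bc].
by move=> [[] []] [[] []] //=; congruence.
Qed.

(** [cube_three] and [rvs_moved_nbr] rule out the coincidences in [vS]; permuting the three
    neighbours yields all the others. *)
Lemma corner_sg i j : corner i <> sg (corner j).
Proof.
have sv := three_moved vabc.
have vS p q r : three_nbrs v p q r -> [/\ v <> sg p, p <> sg v, p <> sg p & p <> sg q].
  move=> t; have/and5P[vp vq vr pq /andP[pr qr]] := t.
  have psv : p <> sg v by move=> h; case/negP: vsv; rewrite -h.
  have psp : p <> sg p.
    move=> h; have psv' : adj p (sg v) by rewrite h sgE adj_sym.
    have := cube_three t psv'; rewrite (negbTE sv) !(inj_eq sgI).
    by rewrite (negbTE (adj_neq vq)) (negbTE (adj_neq vr)).
  split=> //; first by move=> h; apply: psv; rewrite h sgK.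
  move=> h; apply: (@rvs_moved_nbr v q) => //; last by rewrite -h.
  apply/eqP => h'; case/eqP: pq; congruence.
have [t1 t2] := vP; have t0 := vabc.
have u1 : three_nbrs v a c b.
  by case/and5P: vabc => va vb vc ab /andP[ac bc]; rewrite /three_nbrs va vb vc ac ab eq_sym bc.
have u2 : three_nbrs v b c a.
  by case/and5P: t1 => va vb vc ab /andP[ac bc]; rewrite /three_nbrs va vb vc ac ab eq_sym bc.
have u3 : three_nbrs v c b a.
  by case/and5P: t2 => va vb vc ab /andP[ac bc]; rewrite /three_nbrs va vb vc ac ab eq_sym bc.
have [] := (vS _ _ _ t0, vS _ _ _ t1, vS _ _ _ t2).
move=> [[? ? ? ?] [? ? ? ?]] [? ? ? ?].
have [_ _ _ ?] := vS _ _ _ u1; have [_ _ _ ?] := vS _ _ _ u2; have [_ _ _ ?] := vS _ _ _ u3.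
have ? : v <> sg v by apply/nesym/eqP.
by case: i j => [[] []] [[] []].
Qed.

Local Notation o := ((false, false) : cube_index).

Lemma corner_nbr i w : adj (corner i) w ->
  (exists2 j, w = corner j & (i == o) != (j == o)) \/
  (exists2 j, w = sg (corner j) & [&& i != o, j != o & i != j]).
Proof.
have [t1 t2] := vP; case: i => [[] []] /= h.
- case/or3P: (cube_three t2 h) => /eqP->; [left; exists o | right | right] => //.
    by exists (false, true).
  by exists (true, false).
- case/or3P: (cube_three t1 h) => /eqP->; [left; exists o | right | right] => //.
    by exists (false, true).
  by exists (true, true).
- case/or3P: (cube_three vabc h) => /eqP->; [left; exists o | right | right] => //.
    by exists (true, false).
  by exists (true, true).
left; case/and5P: (vabc) => va vb vc ab /andP[ac bc].
case: (w =P a) => [->|/eqP wa]; first by exists (false, true).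
case: (w =P b) => [->|/eqP wb]; first by exists (true, false).
case: (w =P c) => [->|/eqP wc]; first by exists (true, true).
by case: (rvs_no_four va vb vc h ab ac _ bc); rewrite eq_sym.
Qed.

Lemma corner_adj i j : adj (corner i) (corner j) = ((i == o) != (j == o)).
Proof.
apply/idP/idP => [/corner_nbr[]|].
- by case=> k /corner_inj->.
- by case=> k /corner_sg.
case/and5P: (vabc) => va vb vc _ _.
by case: i j => [[] []] [[] []] //= _; rewrite // adj_sym.
Qed.

Lemma corner_adj_sg i j : adj (corner i) (sg (corner j)) =
  [&& i != o, j != o, i != j & cube_link (index_xor i j)].
Proof.
case ij: [&& i != o, j != o & i != j].
  have adjC s t : adj s (sg t) = adj t (sg s) by rewrite -sgE sgK adj_sym.
  by case: i j ij => [[] []] [[] []] //= _; rewrite // adjC.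
have -> : [&& i != o, j != o, i != j & cube_link (index_xor i j)] = false.
  by move: ij; case: (i != o); case: (j != o); case: (i != j).
apply/negP => /corner_nbr[[k /esym/corner_sg//]|[k /sgI/corner_inj <-]].
by rewrite ij.
Qed.

Lemma cube_point_adj p q : adj (cube_point p) (cube_point q) = cube_adj cube_link p q.
Proof.
case: p q => [s i] [t j]; rewrite /cube_point /cube_adj /=.
case: s; case: t; rewrite /= ?sgE ?corner_adj ?corner_adj_sg //.
by rewrite -sgE sgK corner_adj_sg.
Qed.

Lemma cube_point_bij : bijective cube_point.
Proof.
have gI : injective cube_point.
  move=> [s i] [t j]; rewrite /cube_point /=.
  by case: s t => [] [] /= => [/sgI/corner_inj->|/esym/corner_sg|/corner_sg|/corner_inj->].
apply: (inj_card_bij gI); rewrite -(card_codom gI); apply/subset_leq_card/subsetP => w _.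
move: w; apply: (connected_ind (x := v) connX).
  by apply/codomP; exists (false, o).
move=> s t st /codomP[p Es]; apply/codomP; move: st; rewrite {s}Es.
have h i w : adj (corner i) w -> exists q, w = cube_point q.
  by case/corner_nbr=> -[k -> _]; [exists (false, k) | exists (true, k)].
case: p => [[] i]; rewrite /cube_point /=; last exact: h.
rewrite -[adj _ _]sgE sgK => /h [[r k] Et].
exists (~~ r, k); rewrite -[t]sgK Et /cube_point /=.
by case: r {Et} => /=; rewrite ?sgK.
Qed.
Lemma cube_like_of_vertex : cube_like X cube_link.
Proof. by exists cube_point; [exact: cube_point_bij | exact: cube_point_adj]. Qed.

(** No vertex is joined to its antipode, so no edge is flipped and every adjacency is a tie. *)
Lemma cube_tied_total d e : connect (tied E z) d e.
Proof.
have nF r : ~~ flipped r.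
  have [g _ gK] := cube_point_bij; apply/eqP => h; have := oedge_adj r.
  rewrite h -[source r]gK /cube_point; case: (g _) => [[] i] /=.
    by rewrite sgE corner_adj_sg eqxx !andbF.
  by rewrite corner_adj_sg eqxx !andbF.
have /connectP[p] := branching_connect connX brX d e.
elim: p d => [|r p IHp] d /=; first by move=> _ ->.
by case/andP=> Edr rp Ee; apply: connect_trans (IHp r rp Ee); apply: tied_unflipped.
Qed.

End Cube.

(** * Every branching vertex joined to its image *)

Section Flips.
Hypothesis flipH : forall v p q r : X, three_nbrs v p q r -> adj v (sg v).

Lemma three_flip (v p q r : X) : three_nbrs v p q r ->
  [|| p == sg v, q == sg v | r == sg v].
Proof.
move=> t; have vs := flipH t; case/and5P: t => vp vq vr pq /andP[pr qr].
apply/negPn; apply/negP => /norP[ps /norP[qs rs]].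
exact: (rvs_no_four vp vq vr vs pq pr ps qr qs rs).
Qed.

(** A third neighbour [w] of [v] would be [sg v]. As seen from [(u, v)], the edges [(v, x)],
    [(v, w)] and [(y, u)] then share an [R2]-side, which forces [w = sg y] and so [y = v]. *)
Lemma crossed_degree2 (u v x y w : X) : adj u v -> adj v x -> adj y u -> v != sg u ->
  u != x -> y != v -> x = sg y -> adj v w -> (w == u) || (w == x).
Proof.
move=> uv vx yu vsu ux yv Ex vw; apply/negPn; apply/negP => /norP[wu wx].
have vu : adj v u by rewrite adj_sym.
have usv : (u == sg v) = false by rewrite -(inv_eq sgK) eq_sym (negbTE vsu).
have xsv : (x == sg v) = false by rewrite Ex (inj_eq sgI) (negbTE yv).
have wsv : w == sg v.
  have : three_nbrs v u x w by rewrite /three_nbrs vu vx vw ux ![_ == w]eq_sym wu wx.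
  by move/three_flip; rewrite usv xsv.
have Ex1 := gadj_out uv vx ux.
have Ew : E (oedge uv) (oedge vw) by apply: gadj_out; rewrite eq_sym.
have Ey := gadj_in uv yu yv.
have s1 : same_side E R2 (oedge vx) (oedge vw) by rewrite rvs_side_out xsv wsv orbT.
have s2 : same_side E R2 (oedge vx) (oedge yu).
  by rewrite rvs_side_mixed // Ex eqxx (negbTE vsu).
have := side_trans rv2 Ex1 Ew Ey s1 s2.
rewrite rvs_side_mixed 1?eq_sym // (negbTE vsu) addbF (eqP wsv) (inj_eq sgI).
by rewrite (negbTE yv).
Qed.

(** By [crossed_degree2] at [u], [v], [x], carried over by [sg], the graph closes up within [u],
    [v], [x], [sg u], [sg v], [sg x] with degrees at most 2, against branching. *)
Lemma uncrossed (u v x y : X) : adj u v -> adj v x -> adj y u -> v != sg u ->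
  u != x -> y != v -> x != sg y.
Proof.
move=> uv vx yu vsu ux yv; apply/eqP => Ex.
have Ey : y = sg x by rewrite Ex sgK.
have vu : adj v u by rewrite adj_sym. have xv : adj x v by rewrite adj_sym.
have uy : adj u y by rewrite adj_sym.
have usv : u != sg v by rewrite -(inv_eq sgK) eq_sym.
have xsu : adj x (sg u) by rewrite Ex sgE.
have Nv w := crossed_degree2 uv vx yu vsu ux yv Ex (w := w).
have Nu w : adj u w -> (w == v) || (w == y).
  by apply: (crossed_degree2 vu uy xv) => //; rewrite eq_sym.
have Nx w : adj x w -> (w == v) || (w == sg u).
  by apply: (crossed_degree2 vx xsu uv) => //; rewrite Ex (inj_eq sgI).
have sadj s t : adj (sg s) t = adj s (sg t) by rewrite -sgE sgK.
have sNx w : adj (sg x) w -> (w == sg v) || (w == u).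
  by rewrite sadj => /Nx; rewrite !(inv_eq sgK) sgK.
have sNv w : adj (sg v) w -> (w == sg u) || (w == sg x).
  by rewrite sadj => /Nv; rewrite !(inv_eq sgK).
have sNu w : adj (sg u) w -> (w == sg v) || (w == x).
  by rewrite sadj => /Nu; rewrite !(inv_eq sgK) Ey sgK.
pose P t := t \in [:: u; v; x; sg u; sg v; sg x].
have key t : P t -> exists c d, [/\ P c, P d & forall w, adj t w -> (w == c) || (w == d)].
  rewrite /P !inE => /or4P[/eqP->|/eqP->|/eqP->|/or3P[/eqP->|/eqP->|/eqP->]].
  - by exists v, y; split; rewrite ?Ey ?inE ?eqxx ?orbT // -Ey.
  - by exists u, x; split; rewrite ?inE ?eqxx ?orbT.
  - by exists v, (sg u); split; rewrite ?inE ?eqxx ?orbT.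
  - by exists (sg v), x; split; rewrite ?inE ?eqxx ?orbT.
  - by exists (sg u), (sg x); split; rewrite ?inE ?eqxx ?orbT.
  - by exists (sg v), u; split; rewrite ?inE ?eqxx ?orbT.
have allP : forall t, P t.
  apply: (connected_ind (x := u) connX); first by rewrite /P inE eqxx.
  by move=> s t st /key[c [d [Pc Pd /(_ t st)/orP[]/eqP->]]].
case: brX => v0 [p [q [r [[vp vq vr] [pq pr qr]]]]].
have [c [d [_ _ h]]] := key v0 (allP v0).
move: (h _ vp) (h _ vq) (h _ vr) pq pr qr.
by do 3![case/orP=> /eqP->]; rewrite ?eqxx.
Qed.

Lemma out_form (a b : oriented_edge X) : edge_adj a b ->
  exists x (vx : adj (target a) x), b = oedge vx /\ source a != x.
Proof.
case/andP=> /eqP h nb; have vx : adj (target a) (target b) by rewrite h oedge_adj.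
by exists (target b), vx; split=> //; apply: oedge_inj.
Qed.

Lemma in_form (a b : oriented_edge X) : edge_adj b a ->
  exists y (yu : adj y (source a)), b = oedge yu /\ y != target a.
Proof.
case/andP=> /eqP h nb; have yu : adj (source b) (source a) by rewrite -h oedge_adj.
by exists (source b), yu; split=> //; apply: oedge_inj.
Qed.

Lemma unflipped_out (u v x y : X) : adj v u -> adj v x -> adj v y -> v != sg u ->
  u != x -> u != y -> x != y -> (x == sg v) (+) (y == sg v).
Proof.
move=> vu vx vy vsu ux uy xy.
have : three_nbrs v u x y by rewrite /three_nbrs vu vx vy ux uy xy.
move/three_flip; have -> : (u == sg v) = false.
  by rewrite -(inv_eq sgK) eq_sym (negbTE vsu).
rewrite /=; case: (x =P sg v) => [Ex|_] //= _.
by rewrite -Ex eq_sym (negbTE xy).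
Qed.

(** For [R2], edges at opposite ends of [a] are separated by [uncrossed], and two different edges at
    one end share a side because exactly one of them is flipped. *)
Lemma unflipped_sides (a b c : oriented_edge X) : ~~ flipped a -> E a b -> E a c ->
  (edge_adj a b == edge_adj a c) = (O2 a b == O2 a c).
Proof.
move=> Fa Eb Ec; rewrite (revl_side rv2 Eb Ec) -/(same_side E R2 b c).
have mixed (b' c' : oriented_edge X) : edge_adj a b' -> edge_adj c' a ->
    same_side E R2 b' c' = false.
  move=> /out_form[x [vx [-> ux]]] /in_form[y [yu [-> yv]]].
  rewrite rvs_side_mixed ?oedge_adj // -/(flipped a) (negbTE Fa) addbF; apply/negbTE.
  exact: (uncrossed (oedge_adj a) vx yu Fa ux yv).
have ta : adj (target a) (source a) by rewrite adj_sym oedge_adj.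
have na (d : oriented_edge X) : edge_adj d a -> edge_adj a d = false.
  by move/(revlN rvX)/negbTE.
case/orP: (Eb) (Ec) => hb /orP[] hc.
- rewrite hb hc; apply/esym.
  move: hb hc => /out_form[x [vx [-> ux]]] /out_form[y [vy [-> uy]]].
  rewrite rvs_side_out; case: (x =P y) => //= /eqP xy.
  exact: (unflipped_out ta vx vy).
- by rewrite hb (na _ hc) mixed.
- by rewrite hc (na _ hb) (side_sym rv2 Eb Ec) mixed.
rewrite (na _ hb) (na _ hc) eqxx; apply/esym.
move: hb hc => /in_form[x [xu [-> xv]]] /in_form[y [yu [-> yv]]].
rewrite rvs_side_in; case: (x =P y) => //= /eqP xy.
have ux : adj (source a) x by rewrite adj_sym. have uy : adj (source a) y by rewrite adj_sym.
apply: (unflipped_out (oedge_adj a) ux uy) => //; rewrite 1?eq_sym //.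
by rewrite (inv_eq sgK).
Qed.

Lemma ex_flipped : exists2 f, flipped f & exists b, E f b.
Proof.
case: brX => v [p [q [r [[vp vq vr] [pq pr qr]]]]].
have vs : adj v (sg v).
  by apply: (@flipH v p q r); rewrite /three_nbrs vp vq vr pq pr qr.
exists (oedge vs); first by rewrite /flipped.
have [y vy ys] : exists2 y, adj v y & y != sg v.
  by case: (p =P sg v) => [<-|/eqP]; [exists q; rewrite // eq_sym | exists p].
have yv : adj y v by rewrite adj_sym.
by exists (oedge yv); apply: gadj_in.
Qed.

(** As [z] commutes with [R2], it keeps or reverses [O2] globally. Keeping it would put a neighbour
    [b] of a flipped edge, which [z] fixes, on the same [R2]-side as [z b], so [b] would be flipped
    too. *)
Lemma z_reverses a b : E a b -> O2 (z a) (z b) = O2 b a.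
Proof.
move: a b; have Oz a b : E a b -> O2 (z b) (z a) = ~~ O2 (z a) (z b).
  by rewrite -rvs_z_mono => /(revl_asym rv2).
have sides a b c : E a b -> E a c ->
    (O2 a b == O2 a c) = (O2 (z a) (z b) == O2 (z a) (z c)).
  move=> Eb Ec; rewrite (revl_side rv2 Eb Ec) (revl_side rv2) ?rvs_z_mono //.
  by rewrite (inj_eq (inv_inj rvs_zK)) -[rev_edge (z (z c))]rvs_z_rev rvs_z_mono.
case: (@orientation_global _ E O2 (relpre z O2) (revl_sym rv2)
  (revl_asym rv2) Oz sides (branching_connect connX brX)) => //= h.
have [f Ff [b Efb]] := ex_flipped; move: (Ff); rewrite -z_flipped => /eqP zf.
have Efz : E f (z b) by rewrite -zf rvs_z_mono.
have := revl_side rv2 Efb Efz; have := h f b Efb; rewrite zf => ->.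
rewrite eqxx rvs_zK (negbTE (revl_far1 rvX b)) orbF eq_sym z_flipped.
by move/esym; rewrite (negbTE (flipped_indep Efb Ff)).
Qed.

(* R1 changes coherence and z keeps it, so no chain of ties leads from an
   unflipped edge to its reverse. *)
Definition coherent (a : oriented_edge X) :=
  [forall b, E a b ==> (O2 a b == edge_adj a b)].

Lemma coherentP a : reflect (forall b, E a b -> O2 a b = edge_adj a b) (coherent a).
Proof.
apply: (iffP forallP) => h b; first by move=> Eab; apply/eqP/(implyP (h b)).
by apply/implyP => Eab; rewrite h.
Qed.

Lemma incoherentP a : ~~ flipped a -> ~~ coherent a ->
  forall b, E a b -> O2 a b = edge_adj b a.
Proof.
(* Equality of sides is known only at unflipped edges, so [E] is restricted to pairs that start at
   [a]. *)
move=> Fa Ca b Eab; pose Ea c d := (c == a) && E c d.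
have [||h|h] := @orientation_local _ Ea (@edge_adj X) O2 _ _ a.
- by move=> c d /andP[_ /(revl_asym rvX)].
- by move=> c d t /andP[/eqP-> Ed] /andP[_ Et]; apply: unflipped_sides.
- by case/coherentP: Ca => c Eac; apply: h; rewrite /Ea eqxx.
by apply: h; rewrite /Ea eqxx.
Qed.

Lemma has_nbr a : exists b, E a b.
Proof.
have /connectP[[|b p]] := branching_connect connX brX a (rev_edge a).
  by move=> _ /eqP; rewrite (negbTE (revl_free rvX a)).
by case/andP=> Eab _ _; exists b.
Qed.

Lemma coherent_adj a b : E a b -> ~~ flipped a -> ~~ flipped b ->
  coherent b = coherent a.
Proof.
have h c d : E c d -> ~~ flipped c -> ~~ flipped d -> coherent c -> coherent d.
  move=> Ecd Fc Fd /coherentP/(_ d Ecd) Ccd; apply: contraT => /(incoherentP Fd)/(_ c).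
  rewrite (revl_sym rv2) => /(_ Ecd); rewrite (revl_asym rv2 Ecd) Ccd.
  by case: (edge_adj c d).
move=> Eab Fa Fb; apply/idP/idP; last exact: h.
by apply: h => //; rewrite (revl_sym rv2).
Qed.

Lemma coherent_z a : coherent (z a) = coherent a.
Proof.
have h c : coherent c -> coherent (z c).
  move/coherentP=> Cc; apply/coherentP => b; rewrite -[b]rvs_zK rvs_z_mono => Ecb.
  have Ebc : E (z b) c by rewrite (revl_sym rv2).
  by rewrite z_reverses // rvs_z_edge (revl_asym rv2 Ecb) (revl_asym rvX Ecb) Cc.
by apply/idP/idP => [/h|/h]; rewrite ?rvs_zK.
Qed.

(** [rev_edge] is [R2] after [z], and both reverse [O2]; so it keeps [O2] while it reverses
    [edge_adj]. *)
Lemma coherent_rev a : ~~ flipped a -> coherent (rev_edge a) = ~~ coherent a.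
Proof.
move=> Fa; have [b Eab] := has_nbr a.
have Ezz : E (z a) (z b) by rewrite rvs_z_mono.
have Orev : O2 (rev_edge a) (rev_edge b) = O2 a b.
  have := revlR rv2 (z a) (z b); rewrite !rvs_zK => ->.
  by rewrite z_reverses // (revl_sym rv2).
have Err : E (rev_edge a) (rev_edge b) by rewrite (revl_mono rvX).
case Ca: (coherent a).
  apply/negP => /coherentP/(_ _ Err); rewrite Orev edge_adj_rev.
  by rewrite (coherentP _ Ca) // (revl_asym rvX Eab); case: (edge_adj a b).
apply: contraT => Cr; have Fr : ~~ flipped (rev_edge a) by rewrite flipped_rev.
have := incoherentP Fr Cr Err; rewrite Orev edge_adj_rev.
rewrite (incoherentP Fa (negbT Ca)) // (revl_asym rvX Eab).
by case: (edge_adj a b).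
Qed.

Lemma tied_coherent a b : connect (tied E z) a b -> ~~ flipped a ->
  ~~ flipped b /\ coherent b = coherent a.
Proof.
case/connectP=> p; elim: p a => [|c p IHp] a /=; first by move=> _ ->.
case/andP=> ac cp Eb Fa; suff [Fc Cc] : ~~ flipped c /\ coherent c = coherent a.
  by have [Fb Cb] := IHp c cp Eb Fc; rewrite Cb Cc.
case/orP: ac => [/eqP->|/andP[Eac]]; first by rewrite flipped_z coherent_z.
rewrite rvs_cross // (negbTE Fa) /= => Fc; split=> //; exact: coherent_adj.
Qed.

Lemma flip_not_tied a : ~~ flipped a -> ~~ connect (tied E z) a (rev_edge a).
Proof.
move=> Fa; apply/negP => /tied_coherent/(_ Fa)[_].
by rewrite coherent_rev //; case: (coherent a).
Qed.

Let tiedC : connect_sym (tied E z).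
Proof. exact: tied_connect_sym (revl_sym rv2) rvs_zK rvs_z_mono. Qed.

Lemma rvs_tied_rev a b : connect (tied E z) a b ->
  connect (tied E z) (rev_edge a) (rev_edge b).
Proof.
apply: tied_morph; first exact: inv_inj (@rev_edgeK X).
  exact: revl_mono rvX.
by move=> c; rewrite rvs_z_rev.
Qed.

(** A path in [gamma X] may cross a flipped edge [f], where ties stop. The neighbours of [f] are
    still linked by ties, reversal and [z], since [z] fixes [f] and exchanges its two ends. *)
Lemma flip_cover a b : ~~ flipped a -> ~~ flipped b ->
  connect (tied E z) a b || connect (tied E z) (rev_edge a) b.
Proof.
pose D c := connect (tied E z) a c || connect (tied E z) (rev_edge a) c.
have Dt c d : connect (tied E z) c d -> D c -> D d.
  by move=> cd /orP[] h; apply/orP; [left|right]; apply: connect_trans h cd.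
have Dr c : D c -> D (rev_edge c).
  by case/orP=> /rvs_tied_rev; rewrite /D ?rev_edgeK => ->; rewrite ?orbT.
have Dz c : D (z c) -> D c by apply: Dt; rewrite tiedC; apply: tied_z.
have Dzz c : D c -> D (z c) by apply: Dt; apply: tied_z.
have Din c d f : flipped f -> edge_adj c f -> edge_adj d f -> D c -> D d.
  move=> Ff cf df Dc; rewrite -[d]rev_edgeK; apply: (Dr (rev_edge d)).
  case: (c =P d) => [<-|cd]; first exact: Dr.
  have Fi e : edge_adj e f -> ~~ flipped e.
    by move=> ef; apply: flipped_indep Ff; rewrite (revlE rvX) ef orbT.
  have Ecd : E c (rev_edge d).
    move: cd cf df => /eqP; rewrite oedge_eq gadjE !oedgeE.
    by move=> cd /andP[/eqP h1 _] /andP[/eqP h2 _]; move: cd; rewrite h1 h2 eqxx andbT => ->.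
  by apply: Dt Dc; apply: tied_unflipped; rewrite ?flipped_rev ?Fi.
have Dflip c d f : flipped f -> E f c -> E f d -> D c -> D d.
  move=> Ff Ec Ed Dc; have zf : z f = f by apply/eqP; rewrite z_flipped.
  have toin e : E f e -> edge_adj e f \/ edge_adj (z e) f.
    by case/orP=> h; [right; rewrite -zf rvs_z_edge | left].
  case: (toin c Ec) (toin d Ed) => hc [] hd.
  - exact: Din hc hd Dc.
  - by apply: Dz; apply: Din hc hd Dc.
  - by apply: Din hc hd _ => //; apply: Dzz.
  - by apply: Dz; apply: Din hc hd _ => //; apply: Dzz.
(* A flipped edge counts as reached when all its neighbours are. *)
pose D' c := if flipped c then [forall d, E c d ==> D d] else D c.
have D'adj c d : E c d -> D' c -> D' d.
  rewrite /D' => Ecd; case Fc: (flipped c).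
    by move/forallP/(_ d)/implyP/(_ Ecd); rewrite (negbTE (flipped_indep Ecd Fc)).
  case Fd: (flipped d) => Dc.
    apply/forallP => e; apply/implyP => Ede.
    by apply: (Dflip c e d) => //; rewrite (revl_sym rv2).
  by apply: Dt Dc; apply: tied_unflipped; rewrite ?Fc ?Fd.
move=> Fa Fb; suff: D' b by rewrite /D' (negbTE Fb).
have walk p c : D' c -> path E c p -> D' (last c p).
  by elim: p c => [|d p IHp] c //= /D'adj Dc /andP[/Dc/IHp].
have /connectP[p ap ->] := branching_connect connX brX a b.
by apply: walk ap; rewrite /D' (negbTE Fa) /D connect0.
Qed.

Section Root.
Variable w : oriented_edge X -> oriented_edge X.
Hypotheses (wE : {mono w : a b / E a b}) (wz : forall a, w (w a) = z a).
Hypothesis nt3 : forall a, ~~ flipped a ->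
  ~~ connect (tied E z) a (rev_edge (w a)).

(* On a component of unflipped edges, which is a path or a cycle, w keeps or
   reverses the directions, so that its square z keeps them: a contradiction. *)
Definition strand : rel (oriented_edge X) :=
  fun a b => [&& E a b, ~~ flipped a & ~~ flipped b].

Lemma strand_sym : symmetric strand.
Proof. by move=> a b; rewrite /strand (revl_sym rv2) [~~ flipped b && _]andbC. Qed.

(** Of two different continuations at one end of [a], one is flipped by [unflipped_out]; so a strand
    continues in at most one way at each end. *)
Lemma strand_side a b c : strand a b -> strand a c ->
  (edge_adj a b == edge_adj a c) = (b == c).
Proof.
case/and3P=> Eb Fa Fb /and3P[Ec _ Fc]; apply/idP/eqP => [|-> //].
have na (d : oriented_edge X) : edge_adj d a -> edge_adj a d = false.
  by move/(revlN rvX)/negbTE.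
have ta : adj (target a) (source a) by rewrite adj_sym oedge_adj.
case/orP: (Eb) (Ec) => hb /orP[] hc; rewrite ?hb ?hc ?(na _ hb) ?(na _ hc) // => _.
  move: hb hc Fb Fc => /out_form[x [vx [-> ux]]] /out_form[y [vy [-> uy]]].
  rewrite /flipped !oedgeE => Fb Fc; apply: oedge_inj; rewrite !oedgeE //.
  apply/eqP; apply: contraT => xy; have := unflipped_out ta vx vy Fa ux uy xy.
  by rewrite (negbTE Fb) (negbTE Fc).
move: hb hc Fb Fc => /in_form[x [xu [-> xv]]] /in_form[y [yu [-> yv]]].
rewrite /flipped !oedgeE => Fb Fc; apply: oedge_inj; rewrite !oedgeE //.
have ux : adj (source a) x by rewrite adj_sym. have uy : adj (source a) y by rewrite adj_sym.
apply/eqP; apply: contraT => xy.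
have Fa' : source a != sg (target a) by rewrite -(inv_eq sgK) eq_sym.
have := unflipped_out (oedge_adj a) ux uy Fa'; rewrite ![target a == _]eq_sym.
move/(_ xv yv xy); rewrite -!(inv_eq sgK) ![sg _ == source a]eq_sym.
by rewrite (negbTE Fb) (negbTE Fc).
Qed.

Lemma strand_morph (f : oriented_edge X -> oriented_edge X) :
  {mono f : a b / E a b} -> (forall a, flipped (f a) = flipped a) ->
  forall a b, connect strand a b -> connect strand (f a) (f b).
Proof.
move=> fE fF a b /connectP[p]; elim: p a => [|c p IHp] a /=; first by move=> _ ->.
case/andP=> ac cp Eb; apply: connect_trans (IHp _ cp Eb); apply: connect1.
by rewrite /strand fE !fF.
Qed.

Lemma tied_strand a b : connect (tied E z) a b -> ~~ flipped a ->
  connect strand a b || connect strand (z a) b.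
Proof.
move=> + Fa; pose D c := connect strand a c || connect strand (z a) c.
have zstrand c d : connect strand c d -> connect strand (z c) (z d).
  exact: (strand_morph rvs_z_mono flipped_z).
have step c d : tied E z c d -> D c /\ ~~ flipped c -> D d /\ ~~ flipped d.
  case/orP=> [/eqP->|/andP[Ecd nE]] [Dc Fc].
    rewrite flipped_z; split=> //; case/orP: Dc => /zstrand; rewrite /D ?rvs_zK => ->//.
    by rewrite orbT.
  move: nE; rewrite rvs_cross // (negbTE Fc) /= => Fd; split=> //.
  have cd : connect strand c d by apply: connect1; rewrite /strand Ecd Fc Fd.
  by case/orP: Dc => /connect_trans/(_ cd) h; rewrite /D h ?orbT.
have walk p c : path (tied E z) c p -> D c /\ ~~ flipped c ->
    D (last c p) /\ ~~ flipped (last c p).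
  by elim: p c => [|d p IHp] c //= /andP[/step cd /IHp h] /cd/h.
by case/connectP=> p ap ->; case: (walk p a ap) => //; rewrite /D connect0.
Qed.

Lemma flip_no_root : False.
Proof.
have wzz a : w (z a) = z (w a) by rewrite -!wz.
have wI : injective w.
  by apply: (@can_inj _ _ _ (w \o z)) => a /=; rewrite wzz wz rvs_zK.
have wF a : flipped (w a) = flipped a by rewrite -!z_flipped -wzz (inj_eq wI).
have wS := strand_morph wE wF.
have [f Ff [a Ea]] := ex_flipped; have Fa := flipped_indep Ea Ff.
have Fza : ~~ flipped (z a) by rewrite flipped_z.
have za : z a != a by rewrite z_flipped.
(* [w a] lies on the strand of [a] or of [z a]; in the second case applying [w] and then [z] gives
   the first. *)
have caw : connect strand a (w a).
  have strandC := sym_connect_sym strand_sym.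
  have: connect (tied E z) a (w a).
    have Fr : ~~ flipped (rev_edge (w a)) by rewrite flipped_rev wF.
    case/orP: (flip_cover Fa Fr) => [h|/rvs_tied_rev]; first by case/negP: (nt3 Fa).
    by rewrite !rev_edgeK.
  move/tied_strand/(_ Fa)/orP=> [//|/wS]; rewrite wzz wz => h.
  rewrite strandC; have := strand_morph rvs_z_mono flipped_z h.
  by rewrite !rvs_zK.
have [b ab] : exists b, strand a b.
  case/connectP: caw => -[_ /= h|b p /= /andP[ab _] _]; last by exists b.
  by case/eqP: za; rewrite -wz !h.
have Oas c d : strand c d -> edge_adj d c = ~~ edge_adj c d.
  by case/and3P=> /(revl_asym rvX).
have wst c d : strand c d -> strand (w c) (w d).
  by rewrite /strand wE !wF.
have Oas' c d : strand c d -> edge_adj (w d) (w c) = ~~ edge_adj (w c) (w d).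
  by move/wst/Oas.
have sides c d e : strand c d -> strand c e ->
    (edge_adj c d == edge_adj c e) = (edge_adj (w c) (w d) == edge_adj (w c) (w e)).
  by move=> cd ce; rewrite !strand_side ?wst // (inj_eq wI).
(* [w] treats directions alike at [a] and at [w a], so [w \o w] keeps them there; but it equals [z],
   which reverses them. *)
have zab : edge_adj (w (w a)) (w (w b)) = ~~ edge_adj a b.
  by rewrite !wz rvs_z_edge Oas.
case: (@orientation_local _ strand (@edge_adj X) (relpre w (@edge_adj X)) Oas sides a) => h.
  have := orientation_connect strand_sym Oas Oas' sides caw h (wst _ _ ab).
  have /= hb := h b ab; rewrite /= zab hb.
  by case: (edge_adj a b).
have := orientation_connect_opp strand_sym Oas Oas' sides caw h (wst _ _ ab).
have /= hb := h b ab; rewrite /= zab Oas' // hb (Oas a b ab).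
by case: (edge_adj a b).
Qed.

End Root.

End Flips.

End Reversing.

(** * The possible involutions commuting with reversal *)

Section Analysis.
Variables (X : sgraph) (connX : connected_graph X) (brX : has_branching X).
Variables (z : oriented_edge X -> oriented_edge X) (O2 : rel (oriented_edge X)).
Local Notation E := (@gamma_adj X).
Local Notation rvX := (reversal_rev_edge X).
Hypotheses (zE : {mono z : a b / E a b}) (zK : involutive z).
Hypothesis zR : {morph z : a / rev_edge a}.
Hypothesis rv2 : reversal E (fun a => rev_edge (z a)) O2.
Variables (a0 : oriented_edge X) (a0z : z a0 != a0).

(** As [z] commutes with reversal, it keeps or reverses all directions; accordingly [z] or
    [rev_edge \o z] is induced by a vertex map. *)
Lemma z_vertex_map :
  exists sg : X -> X, [/\ involutive sg, {mono sg : u v / adj u v} &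
    (forall a, source (z a) = sg (source a) /\ target (z a) = sg (target a)) \/
    (forall a, source (z a) = sg (target a) /\ target (z a) = sg (source a))].
Proof.
have key (g : oriented_edge X -> oriented_edge X) : {homo g : a b / edge_adj a b} ->
    {morph g : a / rev_edge a} -> involutive g ->
    exists sg : X -> X, [/\ involutive sg, {mono sg : u v / adj u v} &
      forall a, source (g a) = sg (source a) /\ target (g a) = sg (target a)].
  move=> gE gR gK; have [f fE] := induced_map a0 connX gE gR.
  have fK : involutive f.
    move=> v; have [b <-] := ex_target a0 connX v.
    by have [_ <-] := fE b; have [_ <-] := fE (g b); rewrite gK.
  exists f; split=> // x y; have h u v : adj u v -> adj (f u) (f v).
    move=> uv; have := oedge_adj (g (oedge uv)).
    by have [-> ->] := fE (oedge uv).
  by apply/idP/idP => /h //; rewrite !fK.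
have Oz a b : E a b -> edge_adj (z b) (z a) = ~~ edge_adj (z a) (z b).
  by rewrite -zE => /(revl_asym rvX).
have sides a b c : E a b -> E a c ->
    (edge_adj a b == edge_adj a c) = (edge_adj (z a) (z b) == edge_adj (z a) (z c)).
  move=> Eb Ec; rewrite (revl_side rvX Eb Ec) (revl_side rvX) ?zE //.
  by rewrite (inj_eq (inv_inj zK)) -zR zE.
have edgeE (a b : oriented_edge X) : edge_adj a b -> E a b.
  by rewrite /gamma_adj => ->.
case: (@orientation_global _ E (@edge_adj X) (relpre z (@edge_adj X)) (revl_sym rvX)
  (revl_asym rvX) Oz sides (branching_connect connX brX)) => /= h.
  have [|//|//|sg [sK sE sz]] := key z; first by move=> a b ab; rewrite h ?edgeE.
  by exists sg; split=> //; left.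
have [|a|a|sg [sK sE sz]] := key (fun a => rev_edge (z a)).
- by move=> a b ab; rewrite edge_adj_rev h // (revl_sym rvX) edgeE.
- by rewrite zR.
- by rewrite zR zK rev_edgeK.
by exists sg; split=> //; right=> a; have [] := sz a; rewrite !oedgeE.
Qed.

(** The roots to be excluded are rotations in a dihedral group, hence inverted by [rev_edge]. *)
Definition rootless := forall (w : oriented_edge X -> oriented_edge X)
    (O3 O4 : rel (oriented_edge X)),
  {mono w : a b / E a b} -> (forall a, w (w a) = z a) ->
  (forall a, w (rev_edge (w a)) = rev_edge a) ->
  reversal E (fun a => rev_edge (w a)) O3 ->
  reversal E (fun a => rev_edge (w (z a))) O4 ->
  (forall a, z a != a -> ~~ connect (tied E z) a (rev_edge (w a))) -> False.

(** The cube arises when [z] reverses directions and some branching vertex is not joined to its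
    image; all other cases fall under the second alternative. *)
Lemma involution_cases :
  ((exists l, cube_like X l) /\ (forall a b, connect (tied E z) a b)) \/
  ((forall a, z a != a -> ~~ connect (tied E z) a (rev_edge a)) /\ rootless).
Proof.
have [sg [sgK sgE [sz|sz]]] := z_vertex_map.
  have zS a : source (z a) = sg (source a) by case: (sz a).
  have zT a : target (z a) = sg (target a) by case: (sz a).
  right; split=> [a _|w O3 O4 wE wz wr rv3 rv4 nt].
    exact: (pres_not_tied connX sgK sgE zS zT rv2 a0z).
  apply: (pres_no_root connX sgK sgE zS zT rv2 brX a0z wE wz wr rv3 rv4) => a.
  by apply: nt; apply: (pres_z_free connX zS zT rv2 a0z).
have zS a : source (z a) = sg (target a) by case: (sz a).
have zT a : target (z a) = sg (source a) by case: (sz a).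
case: (boolP [exists v, exists p, exists q, exists r,
    three_nbrs v p q r && ~~ adj v (sg v)]) => [|/existsPn noq].
  case/existsP=> v /existsP[p /existsP[q /existsP[r /andP[t vs]]]]; left; split.
    by eexists; apply: (cube_like_of_vertex connX sgK sgE zS zT rv2 t vs).
  exact: (cube_tied_total connX sgK sgE zS zT rv2 brX t vs).
have flipH v p q r : three_nbrs v p q r -> adj v (sg v).
  move=> t; apply/negPn; apply: contra (noq v) => vs.
  by apply/existsP; exists p; apply/existsP; exists q; apply/existsP; exists r; apply/andP.
right; split=> [a|w O3 O4 wE wz wr _ _ nt].
  rewrite (z_flipped sgK zS zT).
  exact: (flip_not_tied connX sgK sgE zS zT rv2 brX flipH).
apply: (flip_no_root connX sgK zS zT rv2 brX flipH wE wz) => a.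
by rewrite -(z_flipped sgK zS zT); apply: nt.
Qed.
End Analysis.

(** * Conjugating one reversal to the other *)

Section Twist.
Variables (T : finType) (E O1 : rel T) (R z : T -> T).
Hypotheses (rv : reversal E R O1) (zE : {mono z : a b / E a b}).
Hypotheses (zK : involutive z) (zR : {morph z : a / R a}).
Hypothesis not_tied : forall a, z a != a -> ~~ connect (tied E z) a (R a).

(** No tie leaves [C], so applying [z] on [C] alone keeps adjacency. As [R] exchanges [C] and its
    complement on moved elements, this map conjugates [R] to [R \o z]. *)
Lemma twist_exists : exists t : T -> T,
  [/\ bijective t, {mono t : a b / E a b} & forall a, t (R a) = R (z (t a))].
Proof.
have tC : connect_sym (tied E z) := tied_connect_sym (revl_sym rv) zK zE.
pose rk a := enum_rank (root (tied E z) a).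
(* Of two tied classes exchanged by [R], the one whose root has the smaller rank is chosen; on a
   class preserved by [R], [z] is the identity by [not_tied]. *)
pose C a := rk a < rk (R a).
have tR a b : connect (tied E z) a b -> connect (tied E z) (R a) (R b).
  apply: tied_morph; [exact: revl_inj rv | exact: revl_mono rv | by move=> c; rewrite zR].
have Ct a b : connect (tied E z) a b -> C a = C b.
  by move=> ab; rewrite /C /rk (rootP tC ab) (rootP tC (tR _ _ ab)).
have Cz a : C (z a) = C a by apply/esym/Ct/tied_z.
have CR a : z a != a -> C (R a) = ~~ C a.
  move=> /not_tied nt; rewrite /C (revlK rv) ltnNge leq_eqVlt negb_or.
  rewrite [_ == _ :> nat](_ : _ = false) //; apply/negbTE.
  apply: contra nt => /eqP/val_inj/enum_rank_inj/eqP.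
  by rewrite (root_connect tC) tC.
pose t a := if C a then z a else a.
have tK : involutive t by move=> a; rewrite /t; case Ca: (C a); rewrite ?Cz Ca ?zK.
exists t; split; first exact: inv_bij.
  have mix a b : C a -> ~~ C b -> E (z a) b = E a b.
    move=> Ca Cb; apply/idP/idP => h; apply: contraT => nh.
      have: C (z a) = C b.
        by apply: Ct; apply: connect1; rewrite /tied h zK nh orbT.
      by rewrite Cz Ca (negbTE Cb).
    have: C a = C b by apply: Ct; apply: connect1; rewrite /tied h nh orbT.
    by rewrite Ca (negbTE Cb).
  move=> a b; rewrite /t; case Ca: (C a); case Cb: (C b) => //.
    by rewrite mix ?Cb.
  by rewrite !(revl_sym rv a) mix ?Ca.
move=> a; case: (z a =P a) => [za|/eqP/CR h].
  have zRa : z (R a) = R a by rewrite zR za.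
  by rewrite /t; case: (C a); case: (C (R a)); rewrite ?zRa ?za ?za.
by rewrite /t h; case: (C a); rewrite /= ?zK ?zR.
Qed.
End Twist.

(** * Cube-like graphs are determined by their number of edges *)

Section CubeCount.

Lemma sum_pair (A B : finType) (G : A * B -> nat) :
  \sum_p G p = \sum_a \sum_b G (a, b).
Proof. by rewrite pair_bigA; apply: eq_bigr => -[]. Qed.

Lemma sum_cube_vertex (F : cube_vertex -> nat) :
  \sum_(p : cube_vertex) F p =
  (F (true, (true, true)) + F (true, (true, false)) +
   (F (true, (false, true)) + F (true, (false, false)))) +
  (F (false, (true, true)) + F (false, (true, false)) +
   (F (false, (false, true)) + F (false, (false, false)))).
Proof.
rewrite sum_pair big_bool; congr (_ + _);
  by rewrite (sum_pair (fun i => F (_, i))) big_bool !big_bool.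
Qed.

(** The claws at the corner and at its antipode have 6 edges, each kept index adds 2, and every edge
    counts twice. *)
Lemma card_cube_adj l :
  #|[pred p : cube_vertex * cube_vertex | cube_adj l p.1 p.2]| =
  12 + 4 * (l (false, true) + l (true, false) + l (true, true)).
Proof.
rewrite -sum1_card big_mkcond sum_pair sum_cube_vertex !sum_cube_vertex.
rewrite !inE /cube_adj /index_xor /=.
by case: (l (false, true)); case: (l (true, false)); case: (l (true, true)).
Qed.

Lemma card_cube_like (X : sgraph) l : cube_like X l ->
  #|{: oriented_edge X}| = 12 + 4 * (l (false, true) + l (true, false) + l (true, true)).
Proof.
case=> g [g' gK g'K] gE; rewrite -card_cube_adj card_sig.
pose h (p : cube_vertex * cube_vertex) := (g p.1, g p.2).
have hI : injective h.
  by move=> [a b] [c d] [/(can_inj gK)-> /(can_inj gK)->].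
rewrite -(eq_card (A := [preim h of [pred e : X * X | adj e.1 e.2]])); last first.
  by move=> p; rewrite !inE /= gE.
rewrite card_preim //; apply: eq_card => -[x y]; rewrite !inE /=.
rewrite andbC; case: (adj x y) => //=; apply/esym/codomP.
by exists (g' x, g' y); rewrite /h /= !g'K.
Qed.

(* Two subsets of equal size of the three nonzero indices are exchanged by a
   transposition, and all transpositions of these indices are linear. *)
Lemma cube_relabel (l l' : cube_index -> bool) :
  l (false, true) + l (true, false) + l (true, true) =
  l' (false, true) + l' (true, false) + l' (true, true) ->
  exists pi : cube_index -> cube_index, [/\ involutive pi,
    pi (false, false) = (false, false),
    forall i j, pi (index_xor i j) = index_xor (pi i) (pi j) &
    forall i, i != (false, false) -> l' (pi i) = l i].
Proof.
case E1: (l (false, true)); case E2: (l (true, false)); case E3: (l (true, true));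
case E1': (l' (false, true)); case E2': (l' (true, false));
case E3': (l' (true, true)) => // _;
first
 [ by exists id; split=> // -[[] []]; rewrite ?E1 ?E2 ?E3
 | by exists (fun i => (i.2, i.1));
   split=> [[[] []]||[[] []] [[] []]|[[] []]] //= _; rewrite ?E1 ?E2 ?E3
 | by exists (fun i => (i.1, i.1 (+) i.2));
   split=> [[[] []]||[[] []] [[] []]|[[] []]] //= _; rewrite ?E1 ?E2 ?E3
 | by exists (fun i => (i.1 (+) i.2, i.2));
   split=> [[[] []]||[[] []] [[] []]|[[] []]] //= _; rewrite ?E1 ?E2 ?E3 ].
Qed.

Lemma cube_like_isomorphic (X Y : sgraph) l l' : cube_like X l -> cube_like Y l' ->
  #|{: oriented_edge X}| = #|{: oriented_edge Y}| -> isomorphic X Y.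
Proof.
move=> cX cY; rewrite (card_cube_like cX) (card_cube_like cY) => /addnI/eqP.
rewrite eqn_pmul2l // => /eqP/cube_relabel[pi [piK pi0 piD pil]].
case: cX cY => g [g' gK g'K] gE [h [h' hK h'K] hE].
exists (fun x => h ((g' x).1, pi (g' x).2)); split.
  exists (fun y => g ((h' y).1, pi (h' y).2)) => [x|y]; rewrite ?hK ?gK /= piK.
    by rewrite -surjective_pairing g'K.
  by rewrite -surjective_pairing h'K.
move=> x y; have -> : adj x y = cube_adj l (g' x) (g' y) by rewrite -gE !g'K.
rewrite hE /cube_adj /=.
have p0 i : (pi i == (false, false)) = (i == (false, false)).
  by rewrite -{1}pi0 (inj_eq (inv_inj piK)).
rewrite !p0 (inj_eq (inv_inj piK)) -piD; case: ifP => // _.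
case: (g' x) (g' y) => [s i] [t j] /=.
case: (i =P j) => [->|/eqP ij]; first by rewrite !andbF.
rewrite pil //; apply: contraNneq ij => ij.
by case: i ij => [[] []]; case: j => [[] []].
Qed.
End CubeCount.

(** * The dihedral group generated by the two reversals *)

Lemma bij_mono_sym (T T' : finType) (E : rel T) (E' : rel T') (f : T -> T') (g : T' -> T) :
  cancel g f -> {mono f : a b / E a b >-> E' a b} -> {mono g : a b / E' a b >-> E a b}.
Proof. by move=> gK fE a b; rewrite -fE !gK. Qed.

Lemma finite_order (T : finType) (f : T -> T) : injective f ->
  exists2 n, 0 < n & forall a, iter n f a = a.
Proof.
move=> fI; exists (\prod_x order f x).
  by apply: prodn_gt0 => x; apply: order_gt0.
move=> a; rewrite (bigD1 a) //= mulnC; elim: (\prod_(_ | _) _) => [|m IHm] //.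
by rewrite mulSn iterD IHm iter_order.
Qed.

Lemma odd_part n : 0 < n -> exists k i, n = 2 ^ k * i.*2.+1.
Proof.
move=> n0; exists (logn 2 n), (n`_2^')./2.
have := odd_double_half n`_2^'; rewrite odd_2'nat part_pnat add1n => ->.
by rewrite -p_part partnC.
Qed.

Section TwoReversals.
Variables (X Y : sgraph) (connX : connected_graph X) (connY : connected_graph Y).
Hypotheses (brX : has_branching X) (brY : has_branching Y).
Variable (e0 : oriented_edge X).
Local Notation TX := (oriented_edge X).
Local Notation TY := (oriented_edge Y).
Local Notation EX := (@gamma_adj X).
Local Notation EY := (@gamma_adj Y).
Local Notation rvX := (reversal_rev_edge X).
Local Notation rvY := (reversal_rev_edge Y).

Section Fixed.
Variables (phi : TX -> TY) (psi : TY -> TX).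
Hypotheses (phiK : cancel phi psi) (psiK : cancel psi phi).
Hypothesis phiE : {mono phi : a b / gamma_adj a b}.

Definition pull_rev (a : TX) : TX := psi (rev_edge (phi a)).
Definition rotation (a : TX) : TX := rev_edge (pull_rev a).

Let psiE : {mono psi : a b / gamma_adj a b}.
Proof. exact: bij_mono_sym psiK phiE. Qed.

Lemma pull_revK : involutive pull_rev.
Proof. by move=> a; rewrite /pull_rev psiK rev_edgeK phiK. Qed.

Lemma pull_rev_mono : {mono pull_rev : a b / EX a b}.
Proof. by move=> a b; rewrite psiE (revl_mono rvY) phiE. Qed.

Lemma rotation_mono n : {mono iter n rotation : a b / EX a b}.
Proof.
elim: n => [|n IHn] a b //=.
by rewrite (revl_mono rvX) pull_rev_mono IHn.
Qed.

Lemma rotation_inj n : injective (iter n rotation).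
Proof.
elim: n => [|n IHn] a b //= /(inv_inj (@rev_edgeK X))/(inv_inj pull_revK).
exact: IHn.
Qed.

Lemma rotation_bij n : bijective (iter n rotation).
Proof. exact: injF_bij (@rotation_inj n). Qed.

Lemma rotation_rev n a : iter n rotation (rev_edge (iter n rotation a)) = rev_edge a.
Proof.
elim: n a => [|n IHn] a //; rewrite iterSr iterS /rotation !rev_edgeK pull_revK.
exact: IHn.
Qed.

Lemma rotation_pull n a : iter n rotation (pull_rev (iter n rotation a)) = pull_rev a.
Proof.
elim: n a => [|n IHn] a //; rewrite iterSr iterS /rotation pull_revK rev_edgeK.
exact: IHn.
Qed.

Lemma iter_comm m n a :
  iter m rotation (iter n rotation a) = iter n rotation (iter m rotation a).
Proof. by rewrite -!iterD addnC. Qed.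

(** Dihedral reflections are conjugate by the rotation with exponent [n./2] to one of the two
    generators: to [rev_edge] for even [n], to [pull_rev] for odd [n]. *)
Lemma rev_rotation_conj n : exists (i : nat) (S : TX -> TX),
  (S = @rev_edge X \/ S = pull_rev) /\
  forall a, iter i rotation (rev_edge (iter n rotation a)) = S (iter i rotation a).
Proof.
exists n./2; have := odd_double_half n; case: (odd n) => En.
  exists pull_rev; split; [by right | move=> a; rewrite -{2}En].
  rewrite add1n -addnn -addnS iterD rotation_rev.
  by rewrite iterS /rotation rev_edgeK.
exists (@rev_edge X); split; [by left | move=> a; rewrite -{2}En].
by rewrite add0n -addnn iterD rotation_rev.
Qed.

Lemma reversal_pull : reversal EX pull_rev (relpre phi (@edge_adj Y)).
Proof.
apply: reversal_transport phiE _ rvY; first by exists psi.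
by move=> a; rewrite /pull_rev psiK.
Qed.

Lemma reversal_rotation n :
  exists O, reversal EX (fun a => rev_edge (iter n rotation a)) O.
Proof.
have [i [S [S_or Sn]]] := rev_rotation_conj n.
have [O rvS] : exists O, reversal EX S O.
  by case: S_or => ->; [exists (@edge_adj X); apply: rvX | eexists; apply: reversal_pull].
by eexists; apply: (reversal_transport (rotation_bij i) (rotation_mono i) Sn rvS).
Qed.

Section Involution.
Variable k : nat.
Local Notation z := (iter (2 ^ k) rotation).
Hypothesis zK : involutive z.
Variable a0 : TX.
Hypothesis a0z : z a0 != a0.

Let zE : {mono z : a b / EX a b}. Proof. exact: rotation_mono. Qed.

Let zR : {morph z : a / rev_edge a}.
Proof. by move=> a; have := rotation_rev (2 ^ k) (z a); rewrite zK. Qed.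

Let zP : {morph z : a / pull_rev a}.
Proof. by move=> a; have := rotation_pull (2 ^ k) (z a); rewrite zK. Qed.

Let zY (b : TY) : TY := phi (z (psi b)).

Let zYE : {mono zY : a b / EY a b}.
Proof. by move=> a b; rewrite phiE zE psiE. Qed.

Let zYK : involutive zY.
Proof. by move=> b; rewrite /zY phiK zK psiK. Qed.

Let zYR : {morph zY : b / rev_edge b}.
Proof.
move=> b; have := zP (psi b); rewrite /pull_rev psiK /zY => ->.
by rewrite psiK.
Qed.

Let b0z : zY (phi a0) != phi a0.
Proof. by rewrite /zY phiK (inj_eq (can_inj phiK)). Qed.

Let phiz a : phi (z a) = zY (phi a). Proof. by rewrite /zY phiK. Qed.
Let psiz b : psi (zY b) = z (psi b). Proof. by rewrite /zY phiK. Qed.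

Let reversal_zY : exists O, reversal EY (fun b => rev_edge (zY b)) O.
Proof.
(* On [X] this map is [pull_rev \o z], that is, [rev_edge] after the rotation with exponent
   [1 + 2 ^ k]. *)
have [O rvO] := reversal_rotation (1 + 2 ^ k).
eexists; apply: (@reversal_transport _ _ EY EX O _ _ psi _ psiE _ rvO).
  by exists phi.
by move=> b; rewrite add1n iterS /rotation rev_edgeK /pull_rev phiz psiK.
Qed.

Let tied_phi a b : connect (tied EX z) a b -> connect (tied EY zY) (phi a) (phi b).
Proof. exact: tied_morph (can_inj phiK) phiE phiz a b. Qed.

Let tied_psi a b : connect (tied EY zY) a b -> connect (tied EX z) (psi a) (psi b).
Proof. exact: tied_morph (can_inj psiK) psiE psiz a b. Qed.

(** Ties correspond under [phi], so both graphs fall in the same case of [involution_cases]. In the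
    second case conjugation reduces every reflection to [rev_edge], handled by [X], or to
    [pull_rev], handled by [Y]. *)
Lemma involution_dichotomy : isomorphic X Y \/
  (forall n a, z a != a -> ~~ connect (tied EX z) a (rev_edge (iter n rotation a)))
  /\ rootless z.
Proof.
have [O1 rv1] := reversal_rotation (2 ^ k); have [O2 rv2] := reversal_zY.
have cX := involution_cases connX brX zE zK zR rv1 a0z.
have cY := involution_cases connY brY zYE zYK zYR rv2 b0z.
case: cX cY => [[[l cX] totX]|[ntX rootX]] [[[l' cY] totY]|[ntY _]].
- left; apply: (cube_like_isomorphic cX cY).
  by apply: bij_eq_card; exists psi; [exact: phiK | exact: psiK].
- have := ntY _ b0z; rewrite -[X in connect _ _ X]psiK tied_phi //.
- have := ntX _ a0z; rewrite -[X in connect _ X _]phiK -[X in connect _ _ X]phiK.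
  by rewrite tied_psi.
right; split=> // n a az; have [i [S [S_or Sn]]] := rev_rotation_conj n.
apply/negP => h; have wI := @rotation_inj i.
have {h}: connect (tied EX z) (iter i rotation a) (S (iter i rotation a)).
  rewrite -Sn; apply: (tied_morph wI (rotation_mono i) _ h) => c.
  exact: iter_comm.
have {az}: z (iter i rotation a) != iter i rotation a.
  by rewrite iter_comm (inj_eq wI).
move: (iter i rotation a) => c cz; apply/negP; case: S_or => ->; first exact: ntX.
have cYz : zY (phi c) != phi c by rewrite -phiz (inj_eq (can_inj phiK)).
by apply: contra (ntY _ cYz) => /tied_phi; rewrite /pull_rev psiK.
Qed.

End Involution.
End Fixed.

Lemma isomorphic_of_two_power k (phi : TX -> TY) (psi : TY -> TX) :
  cancel phi psi -> cancel psi phi -> {mono phi : a b / gamma_adj a b} ->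
  (forall a, iter (2 ^ k) (rotation phi psi) a = a) -> isomorphic X Y.
Proof.
move=> phiK psiK phiE; elim: k => [|k IHk] rot1.
  apply: (@rev_commuting_isomorphic X Y phi e0) => //; first by exists psi.
  move=> a; have := rot1 a; rewrite /= /rotation => /(canRL (@rev_edgeK X)).
  by move=> <-; rewrite /pull_rev psiK.
have zK : involutive (iter (2 ^ k) (rotation phi psi)).
  by move=> a; rewrite -iterD addnn -mul2n -expnS.
case: (pickP (fun a => iter (2 ^ k) (rotation phi psi) a != a)) => [a0 a0z|zid]; last first.
  by apply: IHk => a; apply/eqP/negPn; rewrite zid.
have [//|[nt rootX]] := involution_dichotomy phiK psiK phiE zK a0z.
have zE := rotation_mono psiK phiE (2 ^ k).
have zR : {morph iter (2 ^ k) (rotation phi psi) : a / rev_edge a}.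
  move=> a; rewrite -[in LHS](zK a).
  exact: (rotation_rev phiK psiK (2 ^ k) (iter (2 ^ k) (rotation phi psi) a)).
case: k => [|k] in rot1 IHk zK a0 a0z nt rootX zE zR *.
  (* Here [z] is the rotation itself, so [t] conjugates [rev_edge] to [pull_rev] and [phi \o t]
     commutes with reversal. *)
  have [|t [tB tE tR]] := twist_exists rvX zE zK zR; first exact: (nt 0).
  apply: (@rev_commuting_isomorphic X Y (phi \o t) e0) => //.
  - by apply: bij_comp => //; exists psi.
  - by move=> a b; rewrite /= phiE tE.
  by move=> a; rewrite /= tR /rotation rev_edgeK /pull_rev psiK.
(* Now the rotation with exponent [2 ^ k] is a square root of [z], against [rootX]. *)
have [O3 rv3] := reversal_rotation phiK psiK phiE (2 ^ k).
have [O4 rv4] := reversal_rotation phiK psiK phiE (2 ^ k + 2 ^ k.+1).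
case: (rootX (iter (2 ^ k) (rotation phi psi)) O3 O4).
- exact: rotation_mono.
- by move=> a; rewrite -iterD addnn -mul2n -expnS.
- exact: rotation_rev.
- exact: rv3.
- apply: reversal_transport rv4 => //; first by exists id.
  by move=> a; rewrite iterD.
exact: nt.
Qed.

Lemma branching_isomorphic (phi : TX -> TY) : bijective phi ->
  {mono phi : a b / gamma_adj a b} -> isomorphic X Y.
Proof.
move=> [psi phiK psiK] phiE.
have [n n0 rotn] := finite_order (@rotation_inj phi psi phiK psiK 1).
have [k [i En]] := odd_part n0.
pose f := iter i (rotation phi psi).
have [g fK gK] := rotation_bij phiK psiK i.
(* Composing [phi] with [f] replaces the rotation by its odd power [i.*2.+1], whose order divides
   [2 ^ k]. *)
apply: (@isomorphic_of_two_power k (phi \o f) (g \o psi)).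
- by move=> a; rewrite /= phiK fK.
- by move=> b; rewrite /= /f gK psiK.
- by move=> a b; rewrite /= phiE rotation_mono.
have rotE a : rotation (phi \o f) (g \o psi) a = iter i.*2.+1 (rotation phi psi) a.
  have rg c : rev_edge (g c) = f (rev_edge c).
    rewrite -(rotation_rev phiK psiK i (g c)); congr (f (rev_edge _)); exact: gK.
  by rewrite -addnn -addnS iterD iterS; apply: rg.
by move=> a; rewrite (eq_iter rotE) -iterM -En rotn.
Qed.
End TwoReversals.

(** * Graphs without branching and the conclusion *)

Lemma has_branching_dec (X : sgraph) : has_branching X \/ ~ has_branching X.
Proof.
case: (boolP [exists v : X, exists p, exists q, exists r, three_nbrs v p q r]) => h.
  left; case/existsP: h => v /existsP[p /existsP[q /existsP[r]]].
  by case/and5P=> vp vq vr pq /andP[pr qr]; exists v, p, q, r.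
right=> -[v [p [q [r [[vp vq vr] [pq pr qr]]]]]]; case/negP: h.
apply/existsP; exists v; apply/existsP; exists p; apply/existsP; exists q.
by apply/existsP; exists r; rewrite /three_nbrs vp vq vr pq pr qr.
Qed.

Lemma connect_mono (T T' : finType) (E : rel T) (E' : rel T') (f : T -> T') :
  {mono f : a b / E a b >-> E' a b} ->
  forall a b, connect E a b -> connect E' (f a) (f b).
Proof.
move=> fE a b /connectP[p]; elim: p a => [|c p IHp] a /=; first by move=> _ ->.
case/andP=> ac cp Eb; apply: connect_trans (IHp _ cp Eb); apply: connect1.
by rewrite fE.
Qed.

(** For a connected graph with an edge, branching amounts to connectedness of the symmetric edge
    graph, which [phi] carries over. *)
Lemma has_branching_gamma (X Y : sgraph) (phi : oriented_edge X -> oriented_edge Y) :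
  connected_graph X -> connected_graph Y -> bijective phi ->
  {mono phi : a b / gamma_adj a b} -> oriented_edge X ->
  has_branching X -> has_branching Y.
Proof.
move=> connX connY [psi phiK psiK] phiE a brX.
case: (has_branching_dec Y) => // /degree2_not_connect/(_ (phi a))/negP[].
rewrite -[X in connect _ _ X]psiK; apply: connect_mono phiE _ _ _.
exact: branching_connect.
Qed.

Section NoBranching.
Variables (X Y : sgraph) (connX : connected_graph X) (connY : connected_graph Y).
Hypotheses (nbX : ~ has_branching X) (nbY : ~ has_branching Y).
Variables (phi : oriented_edge X -> oriented_edge Y) (a0 : oriented_edge X).
Hypotheses (phiB : bijective phi) (phiE : {mono phi : a b / gamma_adj a b}).

(* Without branching the two orientations of an edge lie in different components
   of gamma X, so phi can be redefined on the component opposite to a0. *)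
Lemma no_branching_isomorphic : isomorphic X Y.
Proof.
have rvX := reversal_rev_edge X; have rvY := reversal_rev_edge Y.
have symX := @gconnect_sym X; have symY := @gconnect_sym Y.
pose D := connect (@gamma_adj X) a0.
pose D' := connect (@gamma_adj Y) (phi a0).
have Drev a : D (rev_edge a) = ~~ D a.
  case Da: (D a).
    apply/negP => Dr; case/negP: (degree2_not_connect nbX a).
    by apply: connect_trans Dr; rewrite symX.
  case/orP: (connect_or_rev connX a0 a) => [|/(revl_connect rvX)].
    by rewrite -/(D a) Da.
  by rewrite rev_edgeK.
have D'rev b : D' b -> ~~ D' (rev_edge b).
  move=> Db; apply/negP => Dr; case/negP: (degree2_not_connect nbY b).
  by apply: connect_trans Dr; rewrite symY.
have Dphi a : D a -> D' (phi a) by apply: connect_mono.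
have Dadj a b : gamma_adj a b -> D a -> D b.
  by move=> ab Da; apply: connect_trans Da (connect1 ab).
have D'adj a b : gamma_adj a b -> D' a -> D' b.
  by move=> ab Da; apply: connect_trans Da (connect1 ab).
pose phi' a := if D a then phi a else rev_edge (phi (rev_edge a)).
have D'phi a : D' (phi' a) = D a.
  rewrite /phi'; case Da: (D a); first exact: Dphi.
  by apply/negbTE/D'rev/Dphi; rewrite Drev Da.
have phiI := bij_inj phiB; have revI Z := inv_inj (@rev_edgeK Z).
have phi'I : injective phi'.
  move=> a b Eab; have := D'phi a; rewrite Eab D'phi => Dab; move: Eab.
  by rewrite /phi' Dab; case: (D a) => [/phiI|/revI/phiI/revI].
apply: (@rev_commuting_isomorphic X Y phi' a0 connX connY).
- by apply: (inj_card_bij phi'I); rewrite (bij_eq_card phiB).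
- move=> a b; have := D'phi a; have := D'phi b.
  case Da: (D a); case Db: (D b) => Dpb Dpa.
  - by rewrite /phi' Da Db phiE.
  - case ab: (gamma_adj a b); first by rewrite (Dadj _ _ ab Da) in Db.
    by apply/negP => /D'adj/(_ Dpa); rewrite Dpb.
  - rewrite (revl_sym rvX a) (revl_sym rvY); case ab: (gamma_adj b a).
      by rewrite (Dadj _ _ ab Db) in Da.
    by apply/negP => /D'adj/(_ Dpb); rewrite Dpa.
  by rewrite /phi' Da Db (revl_mono rvY) phiE (revl_mono rvX).
by move=> a; rewrite /phi' Drev; case: (D a); rewrite /= ?rev_edgeK.
Qed.
End NoBranching.

Lemma edgeless_isomorphic (X Y : sgraph) : connected_graph X -> connected_graph Y ->
  (oriented_edge X -> False) -> (oriented_edge Y -> False) -> isomorphic X Y.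
Proof.
move=> connX connY nX nY.
have single (Z : sgraph) : connected_graph Z -> (oriented_edge Z -> False) ->
    exists z0 : Z, forall z, z = z0.
  move=> connZ nZ; case: (connZ) => /card_gt0P[z0 _] _; exists z0.
  by apply: (connected_ind (x := z0) connZ) => // u v uv; case: (nZ (oedge uv)).
have [x0 hx] := single X connX nX; have [y0 hy] := single Y connY nY.
exists (fun _ => y0); split; first by exists (fun _ => x0) => t; rewrite ?(hx t) ?(hy t).
by move=> x y; rewrite (hx x) (hx y) !adj_irrefl.
Qed.

Lemma isomorphic_gamma (X Y : sgraph) : isomorphic X Y ->
  isomorphic (gamma X) (gamma Y).
Proof.
case=> f [[g fK gK] fE].
have gE : {mono g : x y / adj x y} by move=> x y; rewrite -fE !gK.
pose lift (Z W : sgraph) (h : Z -> W) (hE : {mono h : x y / adj x y})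
  (a : oriented_edge Z) : oriented_edge W :=
  oedge (etrans (hE (source a) (target a)) (oedge_adj a)).
exists (lift X Y f fE); split.
  by exists (lift Y X g gE) => a; apply: oedge_inj; rewrite /lift !oedgeE (fK, gK).
have fI := can_inj fK.
by move=> a b; rewrite /= !gadjE /lift !oedgeE !(inj_eq fI).
Qed.

Theorem theorem2p2 (X Y : sgraph)
    (connX : connected_graph X) (connY : connected_graph Y) :
  isomorphic (gamma X) (gamma Y) <-> isomorphic X Y.
Proof.
split; last exact: isomorphic_gamma.
case=> phi [phiB]; rewrite /= in phi phiB * => phiE; have [psi phiK psiK] := phiB.
have {}phiE : {mono phi : a b / gamma_adj a b} := phiE.
(* Without edges [phi] carries no information; connectedness then leaves a single vertex on each
   side. *)
case: (pickP (fun _ : oriented_edge X => true)) => [a0 _|no]; last first.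
  apply: edgeless_isomorphic => // a; first by have := no a.
  by have := no (psi a).
have psiE : {mono psi : a b / gamma_adj a b} by move=> a b; rewrite -phiE !psiK.
have psiB : bijective psi by exists phi.
case: (has_branching_dec X) => brX; case: (has_branching_dec Y) => brY.
- exact: (branching_isomorphic connX connY brX brY a0 phiB phiE).
- by case: brY; apply: (has_branching_gamma connX connY phiB phiE a0 brX).
- by case: brX; apply: (has_branching_gamma connY connX psiB psiE (phi a0) brY).
exact: (no_branching_isomorphic connX connY brX brY a0 phiB phiE).
Qed.
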